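(* Let $s\geq 0$ and $\overline{\boldsymbol f^-}(t)=(\overline{f_0^-},\ldots,\overline{f_s^-})\in\mathbf{W}_s(t^{-1}k[t^{-1}])$. Let $n_j:=-v_t(\overline{f_j^-})$, where $v_t$ is the $t$-adic valuation (and $n_j:=0$ if $\overline{f_j^-}=0$). If for all $j=0,\ldots,s$ one has $(n_j,p)=1$ or $n_j=0$, then $$\mathrm{Irr}\bigl(\mathrm{M}(0,\overline{\boldsymbol f^-}(t))\bigr)=\max_{0\le j\le s}\bigl(n_j\cdot p^{s-j}\bigr).$$
   Context: $p$ is a prime, $(K,|.|)$ a complete ultrametric field containing $(\mathbb{Q}_p,|.|)$, with residue field $k$, $\omega=|p|^{1/(p-1)}$, $\partial_T=T\frac{d}{dT}$. $\mathcal{A}_K(I)=\{\sum_{i\in\mathbb{Z}}a_iT^i:a_i\in K,\ \sup_i|a_i|\rho^i<\infty\ \forall\rho\in I\}$, $|f|_\rho=\sup_i|a_i|\rho^i$, $\mathcal{R}_K=\bigcup_{\varepsilon>0}\mathcal{A}_K(]1-\varepsilon,1[)$, $\mathcal{R}_H=\mathcal{R}_K\otimes_KH$ for $H/K$ algebraic. Fix a Lubin-Tate series $P(X)\in\mathbb{Z}_p[[X]]$ for the uniformizer $p$ ($P\equiv pX\pmod{X^2}$, $P\equiv X^p\pmod p$) and a generator $(\pi_j)_{j\ge0}$ of its Tate module ($|\pi_j|<1$, $P(\pi_0)=0$, $\pi_0\ne0$, $P(\pi_{j+1})=\pi_j$); $K_s=K(\pi_s)$. $\mathbf{W}_s(R)=\mathbf{W}(R)/\mathrm{V}^{s+1}\mathbf{W}(R)$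 (also for rings without unit). For a lifting $\boldsymbol f^-(T)=(f_0^-,\ldots,f_s^-)\in\mathbf{W}_s(T^{-1}\mathcal{O}_K[T^{-1}])$ of $\overline{\boldsymbol f^-}(t)$, with phantom components $\phi_j^-=\sum_{i=0}^jp^i(f_i^-)^{p^{j-i}}$, let $u=\exp\bigl(\sum_{j=0}^s\pi_{s-j}\phi_j^-(T)/p^j\bigr)$; $\mathrm{M}(0,\overline{\boldsymbol f^-}(t))$ is the rank one differential module over $\mathcal{R}_{K_s}$ with basis $\mathbf e$ and $\partial_T(\mathbf e)=\frac{\partial_T(u)}{u}\mathbf e$. Its isomorphism class does not depend on the lifting. For a rank one module $M$ with $\partial_T(\mathbf e)=g\,\mathbf e$, put $g_{[0]}=1$, $g_{[1]}=g/T$, $g_{[i+1]}=\frac{d}{dT}g_{[i]}+g_{[i]}g_{[1]}$, $Ray(M,\rho)=\min(\rho,\omega[\limsup_i|g_{[i]}|_\rho^{1/i}]^{-1})$. $M$ is solvable if $\lim_{\rho\to1^-}Ray(M,\rho)=1$; then there is an integer $\beta\ge0$ with $Ray(M,\rho)=\rho^{\beta+1}$ for all $\rho<1$ close to $1$, and $\mathrm{Irr}(M):=\beta$. The modules above are solvable. *)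

(* Defs.v *)
From mathcomp Require Import all_boot all_order all_algebra.
From mathcomp Require Import all_classical all_reals all_analysis.

Set Implicit Arguments.
Unset Strict Implicit.
Unset Printing Implicit Defensive.

Import Order.TTheory GRing.Theory Num.Theory.
Import numFieldNormedType.Exports.

Local Open Scope classical_set_scope.
Local Open Scope ring_scope.

(** * Ultrametric fields

    MathComp norms satisfy [`|x *+ n| = `|x| *+ n], which excludes ultrametric
    absolute values, so an absolute value is a plain function [v : F -> R]. *)

Section Ultrametric.
Variables (R : realType) (F : fieldType) (v : F -> R).

Record ultrametric_abs : Prop := UltrametricAbs {
  uabs_ge0 : forall x, 0 <= v x;
  uabs_eq0 : forall x, v x = 0 <-> x = 0;
  uabsM : forall x y, v (x * y) = v x * v y;
  uabsD : forall x y, v (x + y) <= Num.max (v x) (v y) }.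

Definition vcvg (x : nat -> F) (l : F) : Prop :=
  v (x n - l) @[n --> \oo] --> (0 : R).

Definition vcauchy (x : nat -> F) : Prop :=
  forall e : R, 0 < e ->
    exists N, forall m n, (N <= m)%N -> (N <= n)%N -> v (x m - x n) < e.

Definition vcomplete : Prop :=
  forall x : nat -> F, vcauchy x -> exists l, vcvg x l.

Definition vint : set F := [set x | v x <= 1].

(** When [F] is complete and [v] restricts to the [p]-adic absolute value on
    the rationals, this closure of the integers is (the image of) [Z_p]. *)
Definition Zp_in : set F :=
  [set x | forall e : R, 0 < e -> exists z : int, v (x - z%:~R) < e].

(** [k], with the reduction map [red : O_F -> k], is the residue field of [F].
    The values of [red] outside [O_F] are irrelevant. *)
Record residue_map (k : fieldType) (red : F -> k) : Prop := ResidueMap {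
  red1 : red 1 = 1;
  redD : forall x y, vint x -> vint y -> red (x + y) = red x + red y;
  redM : forall x y, vint x -> vint y -> red (x * y) = red x * red y;
  red_ker : forall x, vint x -> (red x = 0 <-> v x < 1);
  red_surj : forall z, exists2 x, vint x & red x = z }.

End Ultrametric.

(** [Omega], with [iota : K -> Omega], is an algebraic closure of [K]. *)
Definition algebraic_closure (K : fieldType) (Omega : closedFieldType)
    (iota : {rmorphism K -> Omega}) : Prop :=
  forall x : Omega, algebraicOver iota x.

(** The subfield [K(x)] of an extension [Omega] of [K]. *)
Definition adjoin (K Omega : fieldType) (iota : {rmorphism K -> Omega})
    (x : Omega) : set Omega :=
  [set y | exists q r : {poly K},
     (map_poly iota r).[x] != 0 /\
     y = (map_poly iota q).[x] / (map_poly iota r).[x]].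

(** * Lubin-Tate series; power series are given by their coefficients *)

Record lubin_tate (R : realType) (K : fieldType) (v : K -> R) (p : nat)
    (P : nat -> K) : Prop := LubinTate {
  lt_int : forall i, Zp_in v (P i);
  lt_coef0 : P 0%N = 0;
  lt_coef1 : P 1%N = p%:R;
  lt_modp : forall i, exists2 y, Zp_in v y & P i - (i == p)%:R = p%:R * y }.

Definition series_value (R : realType) (K Omega : fieldType)
    (iota : {rmorphism K -> Omega}) (v : Omega -> R) (P : nat -> K)
    (x y : Omega) : Prop :=
  vcvg v (fun n => \sum_(i < n) iota (P i) * x ^+ i) y.

Record tate_generator (R : realType) (K Omega : fieldType)
    (iota : {rmorphism K -> Omega}) (v : Omega -> R) (P : nat -> K)
    (pi : nat -> Omega) : Prop := TateGenerator {
  tate_lt1 : forall j, v (pi j) < 1;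
  tate_root : series_value iota v P (pi 0%N) 0;
  tate_neq0 : pi 0%N != 0;
  tate_succ : forall j, series_value iota v P (pi j.+1) (pi j) }.

(** * Laurent series [\sum_(i in Z) a_i T^i], given by their coefficients *)

Definition laurent (F : Type) : Type := int -> F.

Section Laurent.
Variables (R : realType) (F : fieldType) (v : F -> R).
Implicit Types a b g : laurent F.

Definition gauss_norm a (rho : R) : \bar R :=
  ereal_sup (range (fun i : int => (v (a i) * rho ^ i)%:E)).

Definition analytic (I : set R) : set (laurent F) :=
  [set a | forall rho, I rho -> (gauss_norm a rho < +oo)%E].

Definition robba : set (laurent F) :=
  [set a | exists2 e : R, 0 < e < 1 & analytic `]1 - e, 1[ a].

(** The value is meaningful only if the series defining every coefficient
    converges, which is the case in a Robba ring. *)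
Definition lmul a b : laurent F := fun n =>
  xget 0 [set l | vcvg v
    (fun N => \sum_(i < N.*2.+1) a (i%:Z - N%:Z) * b (n - (i%:Z - N%:Z))) l].

Definition ladd a b : laurent F := fun n => a n + b n.

Definition lone : laurent F := fun n => (n == 0)%:R.

Definition ldivT a : laurent F := fun n => a (n + 1).

(** d/dT *)
Definition lderiv a : laurent F := fun n => (n + 1)%:~R * a (n + 1).

(** The [g_[i]] attached to [g], so that [(d/dT)^i e = g_[i] e] when
    [T d/dT (e) = g e]; the recursion at [i = 0] gives [g_[1] = g / T]. *)
Fixpoint lconn g (i : nat) : laurent F :=
  if i is i'.+1 then ladd (lderiv (lconn g i')) (lmul (lconn g i') (ldivT g))
  else lone.

End Laurent.

(** [R_K (x)_K H], for a subfield [H] of an algebraic extension [Omega] of [K],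
    seen inside the Laurent series over [Omega]. *)
Definition robba_ext (R : realType) (K Omega : fieldType)
    (iota : {rmorphism K -> Omega}) (v : K -> R) (H : set Omega) :
    set (laurent Omega) :=
  [set a | exists n (h : 'I_n -> Omega) (b : 'I_n -> laurent K),
     [/\ forall i, H (h i), forall i, robba v (b i) &
         forall m, a m = \sum_(i < n) h i * iota (b i m)]].

(** * Rank one differential modules

    A rank one module over the ring of Laurent series [A], with a basis [e]:
    it is determined by [conn] such that [T d/dT (e) = conn e]. *)
Record rank_one_module (F : fieldType) (A : set (laurent F)) :=
  RankOneModule { conn : laurent F; conn_in : A conn }.

Section Irregularity.
Variables (R : realType) (F : fieldType) (v : F -> R) (A : set (laurent F)).
Implicit Types M : rank_one_module A.

(** With [omega = |p|^(1/(p-1))]. The inverse is that of [\bar R], for which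
    [0^-1 = +oo]. *)
Definition Ray (p : nat) M (rho : R) : \bar R :=
  Order.min rho%:E
    ((v p%:R `^ ((p.-1)%:R^-1))%:E *
     (limn_esup (fun i =>
        poweR (gauss_norm v (lconn v (conn M) i) rho) (i%:R^-1)))^-1)%E.

Definition solvable_module (p : nat) M : Prop :=
  Ray p M rho @[rho --> (1 : R)^'-] --> 1%:E.

(** [Irr(M) = beta]. *)
Definition is_Irr (p : nat) M (beta : nat) : Prop :=
  solvable_module p M /\
  \forall rho \near (1 : R)^'-, Ray p M rho = (rho ^+ beta.+1)%:E.

Lemma is_Irr_uniq p M beta1 beta2 :
  is_Irr p M beta1 -> is_Irr p M beta2 -> beta1 = beta2.
Proof.
move=> [_ h1] [_ h2].
have h3 : \forall rho \near (1 : R)^'-, 0 < rho :> R.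
  by apply: nbhs_left_gt; exact: ltr01.
have h4 : \forall rho \near (1 : R)^'-, rho < 1 :> R by exact: nbhs_left_lt.
have [rho [[e1 e2] [r0 r1]]] :
    exists rho : R, (Ray p M rho = (rho ^+ beta1.+1)%:E /\
      Ray p M rho = (rho ^+ beta2.+1)%:E) /\ 0 < rho /\ rho < 1.
  by apply: (@filter_ex _ (1 : R)^'-); apply: filterI; exact: filterI.
move: e1; rewrite e2 => -[/eqP].
by rewrite eq_le !ler_iXn2l // -eqn_leq eqSS => /eqP.
Qed.

End Irregularity.

(** * Power series in [T^-1]

    [u : nat -> F] stands for [\sum_n u_n T^-n], and [h : {poly F}] for the
    polynomial [h(T^-1)]. *)

Section PowerSeries.
Variable F : fieldType.
Implicit Types (u w : nat -> F) (h : {poly F}).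

Definition fps_mul u w : nat -> F := fun n => \sum_(i < n.+1) u i * w (n - i)%N.

(** [T d/dT] *)
Definition fps_theta u : nat -> F := fun n => - (n%:R * u n).

(** [exp h], for [h] without constant term: [h ^+ i] does not contribute to
    the coefficient of [T^-n] when [i > n]. *)
Definition fps_exp h : nat -> F :=
  fun n => \sum_(i < n.+1) (i`!)%:R^-1 * (h ^+ i)`_n.

Definition laurent_of_fps u : laurent F :=
  fun n => if n <= 0 then u `|n|%N else 0.

(** [g = (T d/dT u) / u], for an invertible [u]. *)
Definition is_dlog u (g : laurent F) : Prop :=
  exists2 w, fps_mul w u = fps_theta u & g = laurent_of_fps w.

End PowerSeries.

(** * The modules [M(0, f^-)]

    The elements of [t^-1 k[t^-1]] and [T^-1 O_K[T^-1]] are polynomials in the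
    variables [t^-1] and [T^-1] without constant term; the elements of
    [W_s(A)] are their Witt components, indexed by ['I_s.+1]. *)

Definition in_Ws (s : nat) (A : nzRingType) (I : set A) (f : 'I_s.+1 -> A) :
    Prop :=
  forall j, I (f j).

Definition Tinv_polys (F : nzRingType) (O : set F) : set {poly F} :=
  [set q | q`_0 = 0 /\ forall i, O q`_i].

(** [- v_t q], the degree of [q] in [t^-1]; it is [0] for [q = 0]. *)
Definition pole_order (k : nzRingType) (q : {poly k}) : nat := (size q).-1.

Definition lifting (R : realType) (K : fieldType) (v : K -> R)
    (k : fieldType) (red : K -> k) (s : nat)
    (fbar : 'I_s.+1 -> {poly k}) (f : 'I_s.+1 -> {poly K}) : Prop :=
  in_Ws (Tinv_polys (vint v)) f /\
  forall (j : 'I_s.+1) (i : nat), red (f j)`_i = (fbar j)`_i.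

Definition phantom_comp (A : nzRingType) (p s : nat) (f : 'I_s.+1 -> A)
    (j : 'I_s.+1) : A :=
  \sum_(i < s.+1 | (i <= j)%N) p%:R ^+ i * f i ^+ (p ^ (j - i)).

Definition pi_exp (K Omega : fieldType) (iota : {rmorphism K -> Omega})
    (p s : nat) (pi : nat -> Omega) (f : 'I_s.+1 -> {poly K}) : nat -> Omega :=
  fps_exp (\sum_(j < s.+1)
    (pi (s - j)%N / p%:R ^+ j) *: map_poly iota (phantom_comp p f j)).

(** [M], with its basis, is [M(0, fbar)] computed with the lifting [f]. *)
Definition is_M0 (K Omega : fieldType) (iota : {rmorphism K -> Omega})
    (p s : nat) (pi : nat -> Omega) (f : 'I_s.+1 -> {poly K})
    (A : set (laurent Omega)) (M : rank_one_module A) : Prop :=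
  is_dlog (pi_exp iota p pi f) (conn M).

(* Main.v *)
(** Write [Z = T^-1].  The connection of the module is a polynomial [g] in [Z], and
    [g_[i]] is [D^i u / u] for [D = d/dT].  The solution factors as
    [u = \prod_i E_(s-i) (f_i)] with [E_m(Y) = exp (\sum_(l <= m) pi_(m-l) Y^(p^l) / p^l)].

    Dwork's lemma, applied over [Z_(p)[X]] with the Frobenius lift [X |-> Q(X)], where
    the polynomial [Q] approximates the Lubin-Tate series, shows that [E_m] has integral
    coefficients.  Hence [E_m (Y + d) / E_m Y] is a power series in [d] whose coefficients
    are integral polynomials in [Y], that of [d^k] having degree at most [k (p^m - 1)].
    With [Y = f_i (T)] and [d = f_i (T + x) - f_i (T)], this bounds the [g_[i]] and
    gives [Ray >= rho^(beta + 1)].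

    For the converse, truncate [f_i] to the polynomial of degree [n_i] with unit leading
    coefficient.  With [Y], [Y + d] the two polynomials, the same series shows that this
    multiplies [u] by a unit close to [1], which does not affect radii smaller than [rho].
    After truncation the term of [g_[i]] of highest degree in [Z] is exactly [(c Z^(beta + 1))^i],
    where [|c| = |pi_0| = |p|^(1/(p-1))], because the [n_i p^(s-i)] with [n_i > 0] are
    pairwise distinct. *)

Require Import Defs.
From mathcomp Require Import all_boot all_order all_algebra.
From mathcomp Require Import all_classical all_reals all_analysis.
From mathcomp Require Import ring lra zify.

Set Implicit Arguments.
Unset Strict Implicit.
Unset Printing Implicit Defensive.

Import Order.TTheory GRing.Theory Num.Theory.
Import numFieldNormedType.Exports.

Local Open Scope ring_scope.

(** * Ultrametric seminorms and Gauss norms *)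

(** The identities about [u], [E_m] and [E_m (Y + d) / E_m Y] hold between power series, while what
    has to be measured are polynomials in [Z]. Series are therefore replaced by polynomials modulo a
    power of the variable, characterised by a linear differential equation, or by truncations with
    an error bounded in norm. Submultiplicative norms suffice: a record of inequalities passes from
    a ring to its polynomial ring with a Gauss norm. This is used twice, for [Z] with radius
    [t = rho^-1] and for the increment [x] of [T]. The bounds have the form [|k!| r^k]. The binomial
    coefficients of Leibniz's rule preserve this form, and [|k!| <= p k w^k] with
    [w = |p|^(1/(p-1))] turns it into a radius, the factor [p k] being lost in the [k]-th root. When
    [beta = 0] the radius is cut off at [rho] and the upper bound on the [g_[i]] is enough; the
    leading term argument serves [beta > 0]. *)

Record ultra_seminorm (R : realFieldType) (B : nzRingType) (N : B -> R) :
    Prop := UltraSeminorm {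
  usn_ge0 : forall x, 0 <= N x;
  usn0 : N 0 = 0;
  usn1 : N 1 <= 1;
  usnN : forall x, N (- x) <= N x;
  usnD : forall x y, N (x + y) <= Num.max (N x) (N y);
  usnM : forall x y, N (x * y) <= N x * N y }.

Section UltraSeminorm.
Variables (R : realFieldType) (B : nzRingType) (N : B -> R).
Hypothesis hN : ultra_seminorm N.

Lemma usnD_le x y M : N x <= M -> N y <= M -> N (x + y) <= M.
Proof. by move=> hx hy; apply: le_trans (usnD hN _ _) _; rewrite ge_max hx. Qed.

Lemma usnB_le x y M : N x <= M -> N y <= M -> N (x - y) <= M.
Proof. by move=> hx hy; apply: usnD_le => //; apply: le_trans (usnN hN _) _. Qed.

Lemma usnM_le x y M M' : N x <= M -> N y <= M' -> N (x * y) <= M * M'.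
Proof.
by move=> hx hy; apply: le_trans (usnM hN _ _) _; apply: ler_pM; rewrite ?(usn_ge0 hN).
Qed.

Lemma usn_sum_le (I : Type) (r : seq I) (P : pred I) (F : I -> B) (M : R) :
  0 <= M -> (forall i, P i -> N (F i) <= M) -> N (\sum_(i <- r | P i) F i) <= M.
Proof.
move=> M0 h; elim/big_ind: _ => //; first by rewrite (usn0 hN).
by move=> x y; apply: usnD_le.
Qed.

Lemma usnX_le x n M : N x <= M -> N (x ^+ n) <= M ^+ n.
Proof.
move=> h; elim: n => [|n IH]; first by rewrite !expr0 (usn1 hN).
by rewrite !exprS; apply: usnM_le.
Qed.

Lemma usn_nat n : N n%:R <= 1.
Proof.
elim: n => [|n IH]; first by rewrite (usn0 hN).
by rewrite mulrS; apply: usnD_le => //; apply: (usn1 hN).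
Qed.

Lemma usnMn_le x n M : N x <= M -> N (x *+ n) <= M.
Proof. by move=> h; rewrite -mulr_natr -[M]mulr1; apply: usnM_le => //; apply: usn_nat. Qed.

Lemma usnMl_le1 x y M : N x <= 1 -> N y <= M -> N (x * y) <= M.
Proof. by move=> hx hy; rewrite -[M]mul1r; apply: usnM_le. Qed.

Lemma usnMr_le1 x y M : N x <= M -> N y <= 1 -> N (x * y) <= M.
Proof. by move=> hx hy; rewrite -[M]mulr1; apply: usnM_le. Qed.

Lemma usnDr_lt x y : N y < N x -> N (x + y) = N x.
Proof.
move=> h; apply/eqP; rewrite eq_le (usnD_le _ (ltW h)) //=.
have : N x <= Num.max (N (x + y)) (N y).
  rewrite -{1}[x](addrK y); apply: le_trans (usnD hN _ _) _.
  by rewrite ge_max le_max lexx /= le_max (usnN hN) orbT.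
by rewrite le_max [N x <= N y]leNgt h orbF.
Qed.

End UltraSeminorm.

Section GaussNorm.
Variables (R : realFieldType) (B : nzRingType) (N : B -> R) (t : R).

Definition gauss (q : {poly B}) : R :=
  \big[Num.max/0]_(i < size q) (N q`_i * t ^+ i).

Hypotheses (hN : ultra_seminorm N) (t_ge0 : 0 <= t).

Lemma gauss_ge0 (q : {poly B}) : 0 <= gauss q.
Proof.
rewrite /gauss; elim/big_ind: _ => // [x y x0 y0|i _]; first by rewrite le_max x0.
by rewrite mulr_ge0 ?exprn_ge0 ?(usn_ge0 hN).
Qed.

Lemma gauss_coef (q : {poly B}) i : N q`_i * t ^+ i <= gauss q.
Proof.
have [h|h] := ltnP i (size q); last by rewrite nth_default // (usn0 hN) mul0r gauss_ge0.
by rewrite /gauss (bigD1 (Ordinal h)) //= le_max lexx.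
Qed.

Lemma gauss_le (q : {poly B}) M :
  0 <= M -> (forall i, N q`_i * t ^+ i <= M) -> gauss q <= M.
Proof.
move=> M0 h; rewrite /gauss; elim/big_ind: _ => // x y x0 y0.
by rewrite ge_max x0.
Qed.

Lemma gaussC c : gauss c%:P <= N c.
Proof.
apply: gauss_le => [|[|i]]; rewrite ?(usn_ge0 hN) ?coefC //= ?expr0 ?mulr1 //.
by rewrite (usn0 hN) mul0r (usn_ge0 hN).
Qed.

Lemma gauss_seminorm : ultra_seminorm gauss.
Proof.
split=> [||||p q|p q]; first exact: gauss_ge0.
- by apply/eqP; rewrite eq_le gauss_ge0 andbT; apply: gauss_le => // i; rewrite coef0 (usn0 hN) mul0r.
- by apply: le_trans (gaussC _) _; apply: (usn1 hN).
- move=> q; apply: gauss_le => [|i]; first exact: gauss_ge0.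
  apply: le_trans (gauss_coef q i); rewrite coefN ler_wpM2r ?exprn_ge0 //.
  exact: (usnN hN).
- apply: gauss_le => [|i]; first by rewrite le_max gauss_ge0.
  rewrite coefD; apply: le_trans (ler_wpM2r (exprn_ge0 _ t_ge0) (usnD hN _ _)) _.
  rewrite maxr_pMl ?exprn_ge0 // ge_max !le_max !gauss_coef ?orbT //.
- apply: gauss_le => [|i]; first by rewrite mulr_ge0 ?gauss_ge0.
  rewrite coefM; have [->|tn0] := eqVneq (t ^+ i) 0.
    by rewrite mulr0 mulr_ge0 ?gauss_ge0.
  have tp : 0 < t ^+ i by rewrite lt0r tn0 exprn_ge0.
  rewrite -ler_pdivlMr //; apply: (usn_sum_le hN) => [|j _].
    by rewrite divr_ge0 ?mulr_ge0 ?gauss_ge0 ?ltW.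
  apply: le_trans (usnM hN _ _) _; rewrite ler_pdivlMr //.
  have -> : t ^+ i = t ^+ j * t ^+ (i - j) by rewrite -exprD subnKC // -ltnS.
  rewrite mulrACA; apply: ler_pM; rewrite ?gauss_coef // mulr_ge0 ?exprn_ge0 ?(usn_ge0 hN) //.
Qed.

End GaussNorm.

Section GaussComp.
Variables (R : realFieldType) (F : comNzRingType) (v : F -> R).
Hypothesis hv : ultra_seminorm v.

Lemma usn_comp_poly_le (N : {poly F} -> R) (hN : ultra_seminorm N)
    (hNC : forall c, N c%:P <= v c) (a : R) (m : nat) (c A : {poly F}) :
  1 <= a -> N A <= a -> (forall i, v c`_i <= 1) -> (size c <= m.+1)%N ->
  N (c \Po A) <= a ^+ m.
Proof.
move=> a1 hA hc sc; have a0 : 0 <= a := le_trans ler01 a1.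
rewrite comp_polyE; apply: (usn_sum_le hN) => [|i _]; first exact: exprn_ge0.
rewrite -mul_polyC; apply: (usnMl_le1 hN).
  by apply: le_trans (hNC _) _.
apply: le_trans (usnX_le hN _ hA) _; rewrite ler_weXn2l //.
by rewrite -ltnS; apply: leq_trans sc.
Qed.

End GaussComp.

(** * Derivations and linear differential equations *)

Section EqModX.
Variable S : comNzRingType.
Implicit Types P Q : {poly S}.

(** Congruence modulo ['X^N], the form taken here by identities between power series;
    differentiation costs one order. *)
Definition eqX N P Q := forall i, (i < N)%N -> P`_i = Q`_i.

Lemma eqX_trans N P Q P' : eqX N P Q -> eqX N Q P' -> eqX N P P'.
Proof. by move=> h h' i hi; rewrite h // h'. Qed.

Lemma eqX_le N M P Q : (N <= M)%N -> eqX M P Q -> eqX N P Q.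
Proof. by move=> hNM h i hi; apply: h; apply: leq_trans hNM. Qed.

Lemma eqXD N P P' Q Q' : eqX N P P' -> eqX N Q Q' -> eqX N (P + Q) (P' + Q').
Proof. by move=> h h' i hi; rewrite !coefD h // h'. Qed.

Lemma eqXM N P P' Q Q' : eqX N P P' -> eqX N Q Q' -> eqX N (P * Q) (P' * Q').
Proof.
move=> h h' i hi; rewrite !coefM; apply: eq_bigr => j _.
rewrite h ?h' //; first by apply: leq_ltn_trans hi; rewrite leq_subr.
by apply: leq_ltn_trans hi; rewrite -ltnS.
Qed.

Lemma eqXMn N P Q n : eqX N P Q -> eqX N (P *+ n) (Q *+ n).
Proof. by move=> h i hi; rewrite !coefMn h. Qed.

Lemma eqX_deriv N P Q : eqX N.+1 P Q -> eqX N P^`() Q^`().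
Proof. by move=> h i hi; rewrite !coef_deriv h. Qed.

Lemma eqX_XnM N P : eqX N ('X^N * P) 0.
Proof. by move=> i hi; rewrite coefXnM hi coef0. Qed.

Lemma eqX_ode_uniq (tf : forall n (x : S), x *+ n.+1 = 0 -> x = 0) N q P Q :
  eqX N P^`() (q * P) -> eqX N Q^`() (q * Q) -> P`_0 = Q`_0 -> eqX N.+1 P Q.
Proof.
move=> hP hQ h0; elim/ltn_ind => [[//|i]] IH hi.
suff : (P`_i.+1 - Q`_i.+1) *+ i.+1 = 0 by move/tf/eqP; rewrite subr_eq0 => /eqP.
rewrite mulrnBl -!coef_deriv hP ?hQ // !coefM -sumrB big1 // => j _.
rewrite IH ?subrr // ltnS ?leq_subr //.
by apply: leq_trans (leq_subr _ _) _; apply: ltnW.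
Qed.

End EqModX.

Section Ode.
Variables (S : comUnitRingType) (q : {poly S}).

(** Each new coefficient uses all the previous ones, so the recursion carries their list. The ring
    need not be a field: [F[X]] also occurs, where positive integers are invertible. *)
Fixpoint ode_seq n : seq S :=
  if n is n'.+1 then
    let s := ode_seq n' in
    rcons s (n'.+1%:R^-1 * \sum_(j < n'.+1) q`_j * s`_(n' - j))
  else [:: 1].

(** The coefficients of the solution [E] of [E' = q E] with [E(0) = 1]. *)
Definition ode n := (ode_seq n)`_n.

Lemma size_ode_seq n : size (ode_seq n) = n.+1.
Proof. by elim: n => //= n IH; rewrite size_rcons IH. Qed.

Lemma nth_ode_seq n m : (n <= m)%N -> (ode_seq m)`_n = ode n.
Proof.
elim: m => [|m IH]; first by rewrite leqn0 => /eqP ->.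
rewrite leq_eqVlt => /predU1P[->//|h].
by rewrite /= nth_rcons size_ode_seq h IH.
Qed.

Lemma ode0 : ode 0 = 1. Proof. by []. Qed.

Hypothesis nat_unit : forall n, n.+1%:R \is a @GRing.unit S.

Lemma odeS n : n.+1%:R * ode n.+1 = \sum_(j < n.+1) q`_j * ode (n - j).
Proof.
rewrite /ode /= nth_rcons size_ode_seq ltnn eqxx mulrA divrr // mul1r.
by apply: eq_bigr => j _; rewrite nth_ode_seq // leq_subr.
Qed.

Lemma natS_tf n (x : S) : x *+ n.+1 = 0 -> x = 0.
Proof. by move=> h; apply: (mulrI (nat_unit n)); rewrite mulr0 mulr_natl. Qed.

Definition odep N : {poly S} := \poly_(i < N.+1) ode i.

Lemma odep_deriv N : eqX N (odep N)^`() (q * odep N).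
Proof.
move=> i hi; rewrite coef_deriv coef_poly ltnS hi -mulr_natl odeS coefM.
apply: eq_bigr => j _; rewrite coef_poly ltnS.
by rewrite (leq_trans (leq_subr _ _)) // ltnW.
Qed.

End Ode.

Section Connection.
Variables (B : comNzRingType) (D : B -> B).

(** [dconn a i] is [D^i u / u] for [u] such that [D u = a u]. *)
Fixpoint dconn (a : B) (i : nat) : B :=
  if i is i'.+1 then D (dconn a i') + dconn a i' * a else 1.

Arguments dconn : simpl never.

Lemma dconn0 a : dconn a 0 = 1. Proof. by []. Qed.

Lemma dconnS a i : dconn a i.+1 = D (dconn a i) + dconn a i * a.
Proof. by []. Qed.

Hypotheses (DD : {morph D : x y / x + y}) (DM : forall x y, D (x * y) = D x * y + x * D y).

Lemma der0 : D 0 = 0.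
Proof. by apply: (addrI (D 0)); rewrite -DD !addr0. Qed.

Lemma der1 : D 1 = 0.
Proof. by apply: (addrI (D 1)); rewrite addr0 -{3}[1]mulr1 DM mulr1 mul1r. Qed.

Lemma derN x : D (- x) = - D x.
Proof. by apply/eqP; rewrite -subr_eq0 opprK -DD addNr der0. Qed.

Lemma derB x y : D (x - y) = D x - D y.
Proof. by rewrite DD derN. Qed.

Lemma der_sum (I : Type) (r : seq I) (P : pred I) (F : I -> B) :
  D (\sum_(i <- r | P i) F i) = \sum_(i <- r | P i) D (F i).
Proof. by elim/big_rec2: _ => [|i x y _ <-]; rewrite ?der0 ?DD. Qed.

Lemma derMn x n : D (x *+ n) = D x *+ n.
Proof. by elim: n => [|n IH]; rewrite ?der0 // !mulrS DD IH. Qed.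

Lemma derX x n : D (x ^+ n) = n%:R * x ^+ n.-1 * D x.
Proof.
elim: n => [|n IH]; first by rewrite expr0 der1 !mul0r.
rewrite exprS DM IH /=; case: n {IH} => [|n]; first by rewrite expr0; ring.
by rewrite /= exprS (mulrS 1 n.+1); ring.
Qed.

(** Leibniz's rule for a product of two solutions, that is, for the tensor product of two rank one
    modules. *)
Lemma dconnD a b i :
  dconn (a + b) i = \sum_(k < i.+1) (dconn a k * dconn b (i - k)) *+ 'C(i, k).
Proof.
elim: i => [|i IH]; first by rewrite big_ord1 mulr1.
rewrite dconnS IH der_sum mulr_suml -big_split /=.
under eq_bigr => k _.
  rewrite derMn DM mulrnAl -mulrnDl.
  have -> : D (dconn a k) * dconn b (i - k) + dconn a k * D (dconn b (i - k)) +
     dconn a k * dconn b (i - k) * (a + b) =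
     dconn a k.+1 * dconn b (i - k) + dconn a k * dconn b (i - k).+1 by rewrite !dconnS; ring.
  rewrite mulrnDl; over.
rewrite big_split /= addrC big_ord_recl /= bin0 subn0.
rewrite [RHS]big_ord_recl /= bin0 subn0 -addrA; congr (_ + _).
rewrite [X in _ + X]big_ord_recr [RHS]big_ord_recr /= addrA -big_split /=.
congr (_ + _); last by rewrite /bump /= !add1n subSS !subnn !binn.
by apply: eq_bigr => k _; rewrite /bump /= !add1n subSS subnSK // binS mulrnDr.
Qed.

(** Leibniz's rule for [D^k (a u)], divided by [u]. *)
Lemma dconn_leibniz a k :
  dconn a k.+1 = \sum_(j < k.+1) (iter j D a * dconn a (k - j)) *+ 'C(k, j).
Proof.
elim: k => [|k IH]; first by rewrite big_ord1 dconnS dconn0 der1 mulr1 mul1r add0r.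
rewrite dconnS IH der_sum mulr_suml -big_split /=.
under eq_bigr => j _.
  rewrite derMn DM mulrnAl -mulrnDl.
  have -> : D (iter j D a) * dconn a (k - j) + iter j D a * D (dconn a (k - j)) +
     iter j D a * dconn a (k - j) * a =
     iter j.+1 D a * dconn a (k - j) + iter j D a * dconn a (k - j).+1 by rewrite dconnS /=; ring.
  rewrite mulrnDl; over.
rewrite big_split /= addrC big_ord_recl /= bin0 subn0.
rewrite [RHS]big_ord_recl /= bin0 subn0 -addrA; congr (_ + _).
rewrite [X in _ + X]big_ord_recr [RHS]big_ord_recr /= addrA -big_split /=.
congr (_ + _); last by rewrite /bump /= !add1n subSS !subnn !binn.
by apply: eq_bigr => j _; rewrite /bump /= !add1n subSS subnSK // binS mulrnDr.
Qed.

(** With [C k = (E^(k) / k!) / E] at [b0], [q = E' / E] at [b0] and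
    [b = D b0], the sum is a truncation of [E (b0 + d) / E b0]. *)
Lemma der_taylor_trunc (C : nat -> B) (q b d : B) N :
  (forall k, D (C k) = (k.+1%:R * C k.+1 - q * C k) * b) ->
  D (\sum_(k < N.+1) C k * d ^+ k) =
  - (q * b * \sum_(k < N.+1) C k * d ^+ k) +
  (b + D d) * (\sum_(k < N) k.+1%:R * C k.+1 * d ^+ k) +
  N.+1%:R * C N.+1 * d ^+ N * b.
Proof.
move=> hC; elim: N => [|N IH].
  by rewrite !big_ord1 big_ord0 /= expr0 mulr1 hC; ring.
rewrite big_ord_recr /= DD IH.
rewrite !big_ord_recr /=.
by rewrite DM hC derX /= [d ^+ N.+1]exprS; ring.
Qed.

End Connection.

(** * Values of factorials *)

Lemma logn_fact_div p n : prime p ->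
  logn p n`! = (n %/ p + logn p (n %/ p)`!)%N.
Proof.
move=> pp; rewrite !logn_fact //; case: n => [|n].
  by rewrite div0n !big_geq.
rewrite big_ltn // expn1; congr (_ + _)%N.
have le_n : (n.+1 %/ p <= n)%N by rewrite -ltnS ltn_Pdiv ?prime_gt1.
rewrite big_add1 /=; under eq_bigr => k _ do rewrite expnS divnMA.
rewrite (big_cat_nat (n := (n.+1 %/ p).+1)) //= [X in (_ + X)%N]big1_seq ?addn0 //.
move=> k /andP[_]; rewrite mem_index_iota => /andP[h _].
by rewrite divn_small //; apply: leq_trans h _; apply/ltnW/ltn_expl/prime_gt1.
Qed.

Lemma logn_fact_lt p n : prime p -> (0 < n)%N -> (logn p n`! < n)%N.
Proof.
move=> pp; elim/ltn_ind: n => n IH n0; rewrite logn_fact_div //.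
have [->|m0] := posnP (n %/ p)%N; first by rewrite fact0 logn1 addn0.
have := IH _ (ltn_Pdiv (prime_gt1 pp) n0) m0.
have := leq_divM n p; have := prime_gt1 pp; nia.
Qed.

(** The power [p - 1] of the estimate [|n!| >= ...] inverted, i.e. of [|n!| <= p n |p|^(n/(p-1))],
    cleared of roots and denominators. With [m = n %/ p], the remainder costs at most [p^(p-1)],
    which is exactly what replacing [p m <= n] by [p n] pays for. *)
Lemma expn_fact_le p n : prime p -> (0 < n)%N ->
  (p ^ n <= (p * n) ^ p.-1 * p ^ (p.-1 * logn p n`!))%N.
Proof.
move=> pp; have p1 := prime_gt1 pp; have p0 := prime_gt0 pp.
elim/ltn_ind: n => n IH n0; rewrite logn_fact_div //.
have e := divn_eq n p; have lr := ltn_pmod n p0.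
set m := (n %/ p)%N in e *; set r := (n %% p)%N in e lr *.
have hr : (r <= p.-1)%N by lia.
have [m0|m0] := posnP m.
  rewrite m0 fact0 logn1 muln0 expn0 muln1 expnMn.
  apply: leq_trans (leq_pmulr _ _); last by rewrite expn_gt0 n0.
  by rewrite leq_pexp2l // e m0.
have lt_mn : (m < n)%N by apply: ltn_Pdiv.
have := IH _ lt_mn m0; set L := logn p m`! => IHm.
have -> : (p ^ n = p ^ (p.-1 * m) * (p ^ r * p ^ m))%N.
  by rewrite -!expnD; congr (_ ^ _)%N; nia.
rewrite mulnDr [(p ^ (_ + _))%N]expnD.
have : (p ^ r <= p ^ p.-1)%N by rewrite leq_pexp2l.
have : ((p * m) ^ p.-1 <= n ^ p.-1)%N by rewrite leq_exp2r; nia.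
rewrite [((p * n) ^ _)%N]expnMn.
move: IHm; set a := (p ^ m)%N; set b := ((p * m) ^ _)%N; set c := (p ^ (_ * L))%N.
set d := (p ^ (p.-1 * m))%N; set x := (n ^ _)%N; set y := (p ^ r)%N; set z := (p ^ p.-1)%N.
move=> h1 h2 h3.
rewrite [X in (_ <= X)%N](_ : _ = d * (z * (x * c)))%N; last by lia.
by rewrite leq_mul2l leq_mul ?orbT //; apply: leq_trans h1 _; rewrite leq_mul2r h2 orbT.
Qed.

(** * Absolute values extending the p-adic one *)

Section PadicAbs.
Variables (R : realFieldType) (F : fieldType) (v : F -> R) (p : nat).
Hypotheses (hv : ultra_seminorm v) (vM : {morph v : x y / x * y}).
Hypotheses (v_eq0 : forall x, v x = 0 -> x = 0).
Hypotheses (pp : prime p) (vp : v p%:R = p%:R^-1).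

Lemma abs1 : v 1 = 1.
Proof.
have h : v 1 * v 1 = v 1 * 1 by rewrite -vM !mulr1.
by apply: (mulfI _ h); apply/eqP => /v_eq0/eqP; rewrite oner_eq0.
Qed.

Lemma absX x n : v (x ^+ n) = v x ^+ n.
Proof. by elim: n => [|n IH]; rewrite ?expr0 ?abs1 // !exprS vM IH. Qed.

Lemma absV x : v x^-1 = (v x)^-1.
Proof.
have [->|x0] := eqVneq x 0; first by rewrite invr0 (usn0 hv) invr0.
have vx0 : v x != 0 by apply/eqP => /v_eq0/eqP; apply/negP.
by apply: (mulfI vx0); rewrite -vM !divff // abs1.
Qed.

Lemma absN x : v (- x) = v x.
Proof.
by apply/eqP; rewrite eq_le (usnN hv) -{1}[x]opprK (usnN hv).
Qed.

Lemma abs_gt0 x : x != 0 -> 0 < v x.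
Proof.
move=> x0; rewrite lt0r (usn_ge0 hv) andbT.
by apply/eqP => /v_eq0/eqP; apply/negP.
Qed.

Let p_gt0 : 0 < p%:R :> R. Proof. by rewrite ltr0n prime_gt0. Qed.
Let pV_lt1 : p%:R^-1 < 1 :> R.
Proof. by rewrite invf_lt1 // ltr1n prime_gt1. Qed.

Lemma abs_coprime n : coprime n p -> v n%:R = 1.
Proof.
move=> cop; have n0 : (0 < n)%N.
  by case: n cop => //; rewrite /coprime gcd0n => /eqP h; move: (prime_gt1 pp); rewrite h.
apply/eqP; rewrite eq_le (usn_nat hv) /= leNgt; apply/negP => vn.
case: (egcdnP p n0) => a b e _.
have h : (1 : F) = (a * n)%:R - (b * p)%:R.
  by rewrite e (eqP cop) natrD addrC addKr.
have : v 1 < 1.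
  rewrite h; apply: le_lt_trans (_ : _ <= Num.max (v n%:R) (v p%:R)) _; last first.
    by rewrite gt_max vn vp.
  by apply: (usnB_le hv); rewrite natrM; apply: (usnMl_le1 hv); rewrite ?(usn_nat hv) // le_max lexx ?orbT.
by rewrite abs1 ltxx.
Qed.

Lemma abs_nat n : (0 < n)%N -> v n%:R = p%:R^-1 ^+ logn p n.
Proof.
move=> n0; rewrite -{1}(partnC p n0) natrM vM p_part natrX absX vp.
rewrite abs_coprime ?mulr1 // coprime_sym; apply: (@pnat_coprime p); rewrite ?pnat_id ?part_pnat //.
Qed.

Lemma natF_neq0 n : n.+1%:R != 0 :> F.
Proof.
apply/eqP => h; have := abs_nat (ltn0Sn n); rewrite h (usn0 hv) => /esym/eqP.
by rewrite expf_eq0 invr_eq0 gt_eqF ?andbF.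
Qed.

Lemma abs_fact_le (w : R) n : 0 < w -> w ^+ p.-1 = p%:R^-1 -> (0 < n)%N ->
  v n`!%:R <= p%:R * n%:R * w ^+ n.
Proof.
move=> w0 hw n0; have p1 : (0 < p.-1)%N by have := prime_gt1 pp; lia.
rewrite -(ler_pXn2r p1) ?nnegrE ?mulr_ge0 ?ler0n ?exprn_ge0 ?(usn_ge0 hv) ?(ltW w0) //.
rewrite exprMn -exprM [(n * _)%N]mulnC exprM hw abs_nat ?fact_gt0 // -exprM [(logn _ _ * _)%N]mulnC.
rewrite !exprVn ler_pdivlMr ?exprn_gt0 // mulrC ler_pdivrMr ?exprn_gt0 //.
by rewrite -natrM -!natrX -natrM ler_nat expn_fact_le.
Qed.

End PadicAbs.

(** * Dwork's lemma *)

Record subring_pred (S : nzRingType) (C : S -> Prop) : Prop := SubringPred {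
  sbp1 : C 1;
  sbpB : forall x y, C x -> C y -> C (x - y);
  sbpM : forall x y, C x -> C y -> C (x * y) }.

Section SubringPred.
Variables (S : nzRingType) (C : S -> Prop).
Hypothesis hC : subring_pred C.

Lemma sbp0 : C 0.
Proof. by rewrite -[0](subrr 1); apply: (sbpB hC); apply: (sbp1 hC). Qed.

Lemma sbpN x : C x -> C (- x).
Proof. by rewrite -sub0r; apply: (sbpB hC); apply: sbp0. Qed.

Lemma sbpD x y : C x -> C y -> C (x + y).
Proof. by move=> hx hy; rewrite -[y]opprK; apply: (sbpB hC) => //; apply: sbpN. Qed.

Lemma sbpX x n : C x -> C (x ^+ n).
Proof.
move=> hx; elim: n => [|n IH]; first by rewrite expr0; apply: (sbp1 hC).
by rewrite exprS; apply: (sbpM hC).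
Qed.

Lemma sbpMn x n : C x -> C (x *+ n).
Proof.
by move=> hx; elim: n => [|n IH]; rewrite ?mulr0n ?mulrS; [apply: sbp0|apply: sbpD].
Qed.

Lemma sbp_sum (I : Type) (r : seq I) (P : pred I) (F : I -> S) :
  (forall i, P i -> C (F i)) -> C (\sum_(i <- r | P i) F i).
Proof. by move=> h; elim/big_ind: _ => //; [apply: sbp0|apply: sbpD]. Qed.

Definition coefs_in (P : {poly S}) := forall i, C P`_i.

Lemma coefs_in_subring : subring_pred coefs_in.
Proof.
split=> [i|P Q hP hQ i|P Q hP hQ i].
- by rewrite coef1; case: (i == 0%N); [apply: (sbp1 hC)|apply: sbp0].
- by rewrite coefB; apply: (sbpB hC).
- by rewrite coefM; apply: sbp_sum => j _; apply: (sbpM hC).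
Qed.

Lemma coefs_inC c : C c -> coefs_in c%:P.
Proof. by move=> hc i; rewrite coefC; case: eqP => // _; apply: sbp0. Qed.

Lemma coefs_inX : coefs_in 'X.
Proof. by move=> i; rewrite coefX; case: eqP => _; [apply: (sbp1 hC)|apply: sbp0]. Qed.

End SubringPred.

Section Frobenius.
Variables (S : comNzRingType) (C : S -> Prop) (p : nat).
Hypotheses (hC : subring_pred C) (pp : prime p).

(** Membership in [C] is part of the condition: closure under sums and products needs it, since the
    quotient by [p] must again lie in [C]. *)
Definition frob_at (phi : S -> S) x :=
  C x /\ exists2 c, C c & x ^+ p - phi x = p%:R * c.

Variable phi : {rmorphism S -> S}.

Lemma frob_atD x y : frob_at phi x -> frob_at phi y -> frob_at phi (x + y).
Proof.
move=> [Cx [c Cc hc]] [Cy [d Cd hd]]; split; first exact: sbpD.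
have p1 := prime_gt1 pp.
exists (c + d + \sum_(1 <= i < p) x ^+ (p - i) * y ^+ i *+ ('C(p, i) %/ p)).
  apply: (sbpD hC); first exact: sbpD.
  by apply: sbp_sum => // i _; apply: sbpMn => //; apply: (sbpM hC); apply: sbpX.
rewrite rmorphD exprDn !mulrDr -hc -hd -(big_mkord xpredT (fun i => x ^+ (p - i) * y ^+ i *+ 'C(p, i))).
rewrite big_nat_recr //= big_ltn ?prime_gt0 // subn0 expr0 mulr1 bin0 subnn expr0 mul1r binn.
rewrite mulr_sumr (eq_big_nat _ _ (F1 := fun i => x ^+ (p - i) * y ^+ i *+ 'C(p, i))
  (F2 := fun i => p%:R * (x ^+ (p - i) * y ^+ i *+ ('C(p, i) %/ p)))); first by ring.
move=> i /andP[i1 ip]; rewrite mulr_natl -mulrnA divnK // prime_dvd_bin //.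
by rewrite i1.
Qed.

Lemma frob_atM x y : frob_at phi x -> frob_at phi y -> frob_at phi (x * y).
Proof.
move=> [Cx [c Cc hc]] [Cy [d Cd hd]]; split; first exact: (sbpM hC).
exists (x ^+ p * d + c * (y ^+ p - p%:R * d)).
  apply: (sbpD hC); apply: (sbpM hC) => //; first exact: sbpX.
  apply: (sbpB hC); first exact: sbpX.
  by rewrite mulr_natl; apply: sbpMn.
by rewrite rmorphM exprMn -hd mulrDr mulrCA -hd mulrA -hc; ring.
Qed.

Lemma frob_at0 : frob_at phi 0.
Proof.
split; first exact: sbp0.
by exists 0; [exact: sbp0|rewrite rmorph0 expr0n mulr0 subr0 eqn0Ngt prime_gt0].
Qed.

(** Extends [phi] to polynomials by ['X |-> T]. *)
Definition frob_poly (T : {poly S}) : {poly S} -> {poly S} :=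
  comp_poly T \o map_poly phi.

End Frobenius.

(** The elements satisfying the congruence are closed under sums and products, and constants and
    ['X] generate. It is used for [Z_(p)[X]] with ['X |-> T], then for [Z_(p)[X][Y]] with
    [Y |-> Y^p], where [c = 0]. *)
Lemma frob_at_poly (S : comNzRingType) (C : S -> Prop) (p : nat)
    (phi : {rmorphism S -> S}) (T c : {poly S}) :
  subring_pred C -> prime p -> (forall x, C x -> frob_at C p phi x) ->
  coefs_in C c -> 'X^p - T = p%:R * c ->
  forall P, coefs_in C P -> frob_at (coefs_in C) p (frob_poly phi T) P.
Proof.
move=> hC pp hphi Cc hc P CP; have hC' := coefs_in_subring hC.
rewrite -[P]coefK poly_def.
pose f := (comp_poly T \o map_poly phi : {rmorphism {poly S} -> {poly S}}).
have fX : frob_at (coefs_in C) p f 'X.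
  split; first exact: coefs_inX.
  by exists c => //=; rewrite map_polyX comp_polyX.
have fXn n : frob_at (coefs_in C) p f 'X^n.
  elim: n => [|n IH]; last by rewrite exprS; apply: frob_atM.
  split; first exact: (sbp1 hC').
  by exists 0; [exact: sbp0|rewrite rmorph1 expr1n mulr0 subrr].
elim/big_ind: _ => [|x y hx hy|i _]; first exact: (frob_at0 hC' pp f).
  exact: (frob_atD hC' pp (phi := f)).
rewrite -mul_polyC; apply: (frob_atM hC' (phi := f)) => //.
have [_ [d Cd hd]] := hphi _ (CP i); split; first exact: coefs_inC.
exists d%:P; first exact: coefs_inC.
by rewrite /= map_polyC comp_polyC -rmorphXn -rmorphB hd rmorphM /= polyC_natr.
Qed.

Lemma fermat_little_int p (a : int) : prime p ->
  exists b : int, a ^+ p - a = p%:R * b.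
Proof.
move=> pp; have T : subring_pred (fun _ : int => True) by [].
have fn n : frob_at (fun _ : int => True) p idfun n%:R.
  elim: n => [|n IH]; first exact: (frob_at0 T pp).
  rewrite mulrS; apply: (frob_atD T pp (phi := idfun)) => //; split=> //.
  by exists 0 => //; rewrite expr1n subrr mulr0.
have fN1 : frob_at (fun _ : int => True) p idfun (-1).
  (* For [p = 2] the difference [(-1)^2 - (-1)] is [2]; for odd [p] it vanishes. *)
  split=> //; have [->|op] := even_prime pp; first by exists 1.
  by exists 0 => //; rewrite -signr_odd op expr1 subrr mulr0.
suff [_ [b _ hb]] : frob_at (fun _ : int => True) p idfun a by exists b.
have [|n|n] := intP a; first exact: (fn 0%N).
  by rewrite -[_%:Z]natz; apply: fn.
rewrite -[n.+1%:Z]natz -mulrN1; exact: (frob_atM T (phi := idfun)).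
Qed.

Section Dwork.
Variables (F : fieldType) (p : nat).
Hypotheses (pp : prime p) (nz : forall n, n.+1%:R != 0 :> F).

(** [Z_(p)], inside [F]. *)
Definition Zloc (x : F) := exists (a : int) (b : nat), coprime b p /\ x = a%:~R / b%:R.

Lemma coprime_nz b : coprime b p -> b%:R != 0 :> F.
Proof.
case: b => [|b _]; last exact: nz.
by rewrite /coprime gcd0n => /eqP h; move: (prime_gt1 pp); rewrite h.
Qed.

Lemma Zloc_subring : subring_pred Zloc.
Proof.
split=> [|x y [a [b [hb ->]]] [c [d [hd ->]]]|x y [a [b [hb ->]]] [c [d [hd ->]]]].
- by exists 1, 1%N; rewrite coprime1n divr1.
- exists (a * d%:Z - c * b%:Z), (b * d)%N; rewrite coprimeMl hb hd; split=> //.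
  have := coprime_nz hb; have := coprime_nz hd => h1 h2.
  by rewrite rmorphB !rmorphM /= ?natrM; field; rewrite h1.
- exists (a * c), (b * d)%N; rewrite coprimeMl hb hd; split=> //.
  have := coprime_nz hb; have := coprime_nz hd => h1 h2.
  by rewrite rmorphM /= ?natrM; field; rewrite h1.
Qed.

Lemma Zloc_frob x : Zloc x -> frob_at Zloc p idfun x.
Proof.
move=> Cx; split=> //; have [a [b [hb ->]]] := Cx.
have [c hc] := fermat_little_int a pp; have [d hd] := fermat_little_int b%:Z pp.
(* With [a^p = a + p c] and [b^p = b + p d], the numerator [a^p b - a b^p] of [(a/b)^p - a/b] over
   [b^(p+1)] equals [p (c b - a d)]. *)
exists ((c * b%:Z - a * d)%:~R / (b ^ p.+1)%:R).
  by exists (c * b%:Z - a * d), (b ^ p.+1)%N; rewrite coprimeXl.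
have nb := coprime_nz hb; have hq : b%:R ^+ p != 0 :> F by rewrite expf_neq0.
have ha : (a%:~R : F) ^+ p = a%:~R + p%:R * c%:~R.
  by rewrite -rmorphXn /= -[_ ^+ p](subrK a) hc addrC rmorphD rmorphM /= rmorph_nat.
have hb' : (b%:R : F) ^+ p = b%:R + p%:R * d%:~R.
  have -> : (b%:R : F) = b%:Z%:~R by [].
  by rewrite -rmorphXn /= -[_ ^+ p](subrK b%:Z) hd addrC rmorphD rmorphM /= rmorph_nat.
rewrite /= expr_div_n rmorphB !rmorphM /= natrX exprS ha hb'.
rewrite hb' in hq; have -> : b%:~R = b%:R :> F by [].
by field; rewrite hq.
Qed.

(** The exponent of [p] in [(k+1)!] is at most [k]. *)
Lemma Zloc_div_fact k : Zloc (p%:R ^+ k / k.+1`!%:R).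
Proof.
have h := logn_fact_lt pp (ltn0Sn k); rewrite ltnS in h.
have f0 := fact_gt0 k.+1; have [q hq] := dvdnP (pfactor_dvdnn p k.+1`!).
have pF : p%:R != 0 :> F by case: (p) (prime_gt0 pp).
have hqp : coprime q p.
  rewrite coprime_sym prime_coprime //; apply/negP => /dvdnP[r hr].
  have : (p ^ (logn p k.+1`!).+1 %| k.+1`!)%N.
    by rewrite [X in (_ %| X)%N]hq hr expnS -mulnA dvdn_mull.
  by rewrite pfactor_dvdn // ltnn.
rewrite hq; set L := logn p _ in h *.
exists (p ^ (k - L))%N%:Z, q; split=> //.
rewrite -{1}(subnK h) natrM natrX exprD -pmulrn natrX.
have hp : p%:R ^+ L != 0 :> F by rewrite expf_neq0.
by have := coprime_nz hqp; move: hp => h1 h2; field; rewrite ?h1 ?h2 ?pF.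
Qed.

End Dwork.

Lemma eqX_XnM_shift (S : comNzRingType) k N (P Q : {poly S}) :
  eqX N P Q -> eqX (k + N) ('X^k * P) ('X^k * Q).
Proof.
move=> h i hi; rewrite !coefXnM; case: ltnP => // hk.
by rewrite h // ltn_subLR.
Qed.

Lemma eqX_comp_Xn (S : comNzRingType) k N (P Q : {poly S}) : (0 < k)%N ->
  eqX N P Q -> eqX (k * N) (P \Po 'X^k) (Q \Po 'X^k).
Proof.
move=> k0 h i hi; rewrite !coef_comp_poly_Xn //; case: ifP => // _.
by rewrite h // ltn_divLR // mulnC.
Qed.

Section DworkStep.
Variables (F : fieldType) (p : nat).
Hypotheses (pp : prime p) (nz : forall n, n.+1%:R != 0 :> F).
Variables (T c : {poly F}).
Hypotheses (cc : coefs_in (Zloc p) c).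
Hypothesis hT : 'X^p - T = p%:R * c.

Let S : comUnitRingType := {poly F}.

Lemma poly_nat_unit n : n.+1%:R \is a @GRing.unit S.
Proof.
by rewrite poly_unitE -polyC_natr size_polyC nz coefC eqxx /= unitfE nz.
Qed.
Let nu := poly_nat_unit.

Let C : S -> Prop := coefs_in (Zloc p).
Let hC : subring_pred C := coefs_in_subring (Zloc_subring pp nz).
Let sigma : {rmorphism S -> S} := comp_poly T.

Let frobS x : C x -> frob_at C p sigma x.
Proof.
move=> Cx; have := frob_at_poly (phi := idfun) (Zloc_subring pp nz) pp (@Zloc_frob _ _ pp nz) cc hT Cx.
by rewrite /frob_at /frob_poly /= map_poly_id.
Qed.

Let frobSX (x : {poly S}) : coefs_in C x -> frob_at (coefs_in C) p (frob_poly sigma 'X^p) x.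
Proof.
apply: (frob_at_poly (c := 0) hC pp frobS); first exact: (sbp0 (coefs_in_subring hC)).
by rewrite subrr mulr0.
Qed.

(** When [T] is close to the Lubin-Tate series, its value at [pi_m] is close to [pi_(m-l)]. *)
Definition LTiter l : S := iter l (comp_poly T) 'X.

(** [q = E' / E] for [E = exp (\sum_(l < K) T^(l) Y^(p^l) / p^l)], with [T^(l)] the [l]-th iterate
    of [T]; Dwork's lemma is [E^p = exp (p X Y) E^sigma (Y^p)] up to high order in [Y]. *)
Definition dwork_q K : {poly S} := \sum_(l < K) (LTiter l)%:P * 'X^((p ^ l).-1).

(** The functional equation of [E] at the level of logarithmic derivatives, divided by [p]. *)
Lemma dwork_qS K : dwork_q K.+1 = 'X%:P + 'X^(p.-1) * frob_poly sigma 'X^p (dwork_q K).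
Proof.
rewrite /dwork_q big_ord_recl expn0 expr0 mulr1; congr (_ + _).
rewrite /frob_poly /= !rmorph_sum mulr_sumr; apply: eq_bigr => l _.
rewrite rmorphM /= map_polyC map_polyXn rmorphM /= comp_polyC comp_Xn_poly mulrCA.
congr (_ * _); rewrite -exprM -exprD; congr ('X ^+ _).
have := prime_gt0 pp; have : (0 < p ^ l)%N by rewrite expn_gt0 prime_gt0.
by rewrite /bump /= add1n expnS; nia.
Qed.

(** Lets the functional equation, which relates [K.+1] to [K], be used with a single [q] in degrees
    at most [p^K - 1]. *)
Lemma dwork_qS_eqX K : eqX (p ^ K).-1 (dwork_q K.+1) (dwork_q K).
Proof.
move=> i hi; rewrite /dwork_q big_ord_recr /= coefD coefCM coefXn.
by rewrite ltn_eqF // mulr0 addr0.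
Qed.

Let y1_deriv K n (P := odep (dwork_q K) n) :
  eqX n (P ^+ p)^`() (p%:R * dwork_q K * P ^+ p).
Proof.
rewrite deriv_exp.
have -> : p%:R * dwork_q K * P ^+ p = (dwork_q K * P * P ^+ p.-1) *+ p.
  have -> : P ^+ p = P * P ^+ p.-1 by rewrite -exprS prednK ?prime_gt0.
  by rewrite -[RHS]mulr_natl !mulrA.
by apply: eqXMn; apply: eqXM => //; apply: odep_deriv.
Qed.

Let ode_exp (a : S) i : i`!%:R * ode a%:P i = a ^+ i.
Proof.
elim: i => [|i IH]; first by rewrite mul1r ode0 expr0.
rewrite factS natrM -mulrA mulrCA odeS // big_ord_recl coefC /= subn0 big1.
  by rewrite addr0 mulrCA IH exprS.
by move=> j _; rewrite coefC /= mul0r.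
Qed.

(** All coefficients of [exp (p X Y)] of positive degree in [Y] are divisible by [p]. *)
Let ode_expX i : exists2 g, C g & ode (p%:R * 'X : S)%:P i.+1 = p%:R * g.
Proof.
exists ((p%:R ^+ i / i.+1`!%:R)%:P * 'X ^+ i.+1).
  apply: (sbpM hC); last by apply: (sbpX hC); apply: coefs_inX; apply: Zloc_subring.
  by apply: coefs_inC; [apply: Zloc_subring|apply: Zloc_div_fact].
have hf : i.+1`!%:R \is a @GRing.unit S by case: (i.+1`!) (fact_gt0 i.+1).
apply: (mulrI hf); rewrite ode_exp exprMn !mulrA; congr (_ * _).
rewrite exprS -!mulrA mulrCA; congr (_ * _).
rewrite -!polyC_natr -rmorphXn -rmorphM /=; congr (_%:P).
by rewrite mulrC divfK //; case: (i.+1`!) (fact_gt0 i.+1).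
Qed.

(** Induction on the degree, comparing coefficients of [Y^(n+1)] in
    [E^p = exp (p X Y) E^sigma (Y^p)]. The unknown coefficient occurs only on the left, multiplied
    by [p]; modulo [p] the known parts of both sides agree by the Frobenius congruence for the
    truncation [L]. *)
Lemma dwork_integral K n : (n < p ^ K)%N -> C (ode (dwork_q K) n).
Proof.
have p0 := prime_gt0 pp; have p1 := prime_gt1 pp.
elim/ltn_ind: n => [[|n] IH hn]; first by rewrite ode0; exact: (sbp1 hC).
set q := dwork_q K; set P := odep q n.+1; set L := odep q n.
set G := odep (p%:R * 'X : S)%:P n.+1; set H := frob_poly sigma 'X^p L.
have CL : coefs_in C L.
  move=> i; rewrite coef_poly; case: ifP => [hi|_]; last exact: (sbp0 hC).
  by apply: IH => //; apply: leq_trans hn; apply: ltnW.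
have [CLp [d Cd hd]] := frobSX CL.
have HD : eqX n.+1 ('X^(p.-1) * frob_poly sigma 'X^p L^`())
    ('X^(p.-1) * (frob_poly sigma 'X^p q * H)).
  (* Substituting [Y^p] multiplies the precision [n] by [p], and ['X^(p.-1)] adds [p - 1]: at least
     one order is gained, so [L] suffices on the right. *)
  apply: (@eqX_le _ _ (p.-1 + p * n)); first by nia.
  apply: eqX_XnM_shift; rewrite /H /frob_poly /= -rmorphM /= -rmorphM.
  by apply: eqX_comp_Xn => // i hi; rewrite !coef_map /= odep_deriv.
have y2 : eqX n.+1 (G * H)^`() (p%:R * q * (G * H)).
  rewrite derivM; apply: (@eqX_trans _ _ _ ((p%:R * dwork_q K.+1) * (G * H))); last first.
    apply: eqXM => //; apply: eqXM => //.
    by apply: eqX_le (@dwork_qS_eqX K); rewrite -ltnS prednK ?expn_gt0 ?p0.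
  rewrite dwork_qS; set Q := frob_poly _ _ (dwork_q K).
  have -> : p%:R * ('X%:P + 'X^(p.-1) * Q) * (G * H) =
    (p%:R * 'X : S)%:P * G * H + G * (p%:R * ('X^(p.-1) * (Q * H))).
    by rewrite polyCM polyC_natr; ring.
  apply: eqXD; first by apply: eqXM => //; apply: odep_deriv.
  apply: eqXM => //; rewrite /H {1}/frob_poly /= deriv_comp deriv_map derivXn -mulr_natl.
  rewrite [X in eqX _ X _](_ : _ = p%:R * ('X^(p.-1) * frob_poly sigma 'X^p L^`())); last first.
    by rewrite /frob_poly /=; ring.
  exact: eqXM.
have P0 : P`_0 = 1 by rewrite coef_poly.
have L0 : L`_0 = 1 by rewrite coef_poly.
have H0 i : H`_i = if (p %| i)%N then sigma L`_(i %/ p) else 0.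
  by rewrite /H /frob_poly /= coef_comp_poly_Xn // coef_map.
(* Both sides solve [y' = p q y] with constant term [1]. *)
have E : eqX n.+2 (P ^+ p) (G * H).
  apply: (eqX_ode_uniq (natS_tf nu) (q := p%:R * q)) => //; first exact: y1_deriv.
  by rewrite -!horner_coef0 !hornerE !horner_coef0 P0 expr1n H0 dvdn0 div0n L0 rmorph1 coef_poly mulr1.
(* Since [P] and [L] have constant term [1], the new coefficient enters [P ^+ p] linearly with
   factor [p]. *)
have PL : P = L + (ode q n.+1)%:P * 'X^(n.+1).
  by rewrite /P /L /odep !poly_def big_ord_recr /= mul_polyC.
have EP : (P ^+ p)`_n.+1 = (L ^+ p)`_n.+1 + p%:R * ode q n.+1.
  apply/eqP; rewrite addrC -subr_eq -coefB; apply/eqP.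
  rewrite subrXX {1}PL [L + _]addrC addrK -mulrA coefCM coefXnM ltnn subnn mulrC.
  congr (_ * _); rewrite coef_sum (eq_bigr (fun=> 1)) ?sumr_const ?card_ord //.
  move=> i _; rewrite -horner_coef0 !hornerE !horner_coef0 P0 L0 !expr1n mulr1 //.
have := E _ (ltnSn _); rewrite EP coefM big_ord_recl subn0 [G`__]coef_poly /= ode0 mul1r.
move=> e; have Ce : exists2 g, C g & p%:R * ode q n.+1 = p%:R * g.
  have hsum : exists2 g, C g &
      \sum_(i < n.+1) G`_(bump 0 i) * H`_(n.+1 - bump 0 i) = p%:R * g.
    apply: (big_ind (fun s => exists2 g, C g & s = p%:R * g)).
    - by exists 0; [exact: (sbp0 hC)|rewrite mulr0].
    - by move=> x y [g Cg ->] [g' Cg' ->]; exists (g + g'); [exact: (sbpD hC)|rewrite mulrDr].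
    move=> i _; rewrite /bump /= add1n coef_poly ltnS ltn_ord.
    have [g Cg ->] := ode_expX i.
    exists (g * H`_(n.+1 - i.+1)); last by rewrite mulrA.
    apply: (sbpM hC) => //; rewrite H0; case: ifP => _; last exact: (sbp0 hC).
    have [_ [d' Cd' hd']] := frobS (CL ((n.+1 - i.+1) %/ p)%N).
    rewrite -[sigma _]opprK -[- sigma _](addKr (L`_((n.+1 - i.+1) %/ p) ^+ p)) hd'.
    apply: (sbpN hC); apply: (sbpD hC); first by apply: (sbpN hC); apply: (sbpX hC).
    by rewrite mulr_natl; apply: (sbpMn hC).
  have [g Cg hg] := hsum; exists (g - d`_n.+1); first exact: (sbpB hC).
  have hdn : (L ^+ p)`_n.+1 - H`_n.+1 = p%:R * d`_n.+1.
    by rewrite -coefB -/H hd -[p%:R]polyC_natr coefCM.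
  rewrite mulrBr -hg -hdn; move: e; rewrite -/H => e.
  by apply: (addrI (L ^+ p)`_n.+1); rewrite e; ring.
have [g Cg hg] := Ce.
have pF : p%:R \is a @GRing.unit S by case: (p) p0.
by rewrite (mulrI pF hg).
Qed.

End DworkStep.

(** * Integrality of Lubin-Tate exponentials *)

Section LubinTateExp.
Variables (R : realFieldType) (F : fieldType) (v : F -> R) (p : nat).
Hypotheses (hv : ultra_seminorm v) (vM : {morph v : x y / x * y}).
Hypotheses (v_eq0 : forall x, v x = 0 -> x = 0).
Hypotheses (pp : prime p) (vp : v p%:R = p%:R^-1).

Let nz := natF_neq0 hv vM v_eq0 pp vp.

Lemma natF_unit n : n.+1%:R \is a @GRing.unit F.
Proof. by rewrite unitfE nz. Qed.
Let nu := natF_unit.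

Lemma natF_gt0_neq0 n : (0 < n)%N -> n%:R != 0 :> F.
Proof. by case: n. Qed.

Lemma abs_int (a : int) : v a%:~R <= 1.
Proof.
have [|n|n] := intP a; rewrite ?(usn0 hv) // ?rmorphN /= ?(absN hv) -?pmulrn; exact: usn_nat.
Qed.

Lemma abs_Zloc x : Zloc p x -> v x <= 1.
Proof.
move=> [a [b [hb ->]]]; rewrite vM (absV hv vM v_eq0) (abs_coprime hv vM v_eq0 pp vp hb).
by rewrite invr1 mulr1 abs_int.
Qed.

Lemma abs_horner (P : {poly F}) x : (forall i, v P`_i <= 1) -> v x <= 1 -> v P.[x] <= 1.
Proof.
move=> hP hx; rewrite horner_coef; apply: (usn_sum_le hv) => // i _.
apply: (usnMl_le1 hv) => //; rewrite -(expr1n R i); exact: (usnX_le hv).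
Qed.

Lemma abs_horner_lip (P : {poly F}) x y :
  (forall i, v P`_i <= 1) -> v x <= 1 -> v y <= 1 -> v (P.[x] - P.[y]) <= v (x - y).
Proof.
move=> hP hx hy; rewrite !horner_coef -sumrB.
apply: (usn_sum_le hv) => [|i _]; first exact: (usn_ge0 hv).
rewrite -mulrBr subrXX; apply: (usnMl_le1 hv) => //; apply: (usnMr_le1 hv) => //.
apply: (usn_sum_le hv) => // j _; apply: (usnMl_le1 hv).
  by rewrite -(expr1n R (i.-1 - j)); apply: (usnX_le hv).
by rewrite -(expr1n R j); apply: (usnX_le hv).
Qed.

Lemma abs_fact_gt0 n : 0 < v n`!%:R.
Proof. by apply: (abs_gt0 hv v_eq0); apply/natF_gt0_neq0/fact_gt0. Qed.

Lemma abs_factS n : v n.+1%:R * v n`!%:R = v n.+1`!%:R.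
Proof. by rewrite -vM -natrM. Qed.

Lemma abs_fact_anti m n : (m <= n)%N -> (v m`!%:R)^-1 <= (v n`!%:R)^-1.
Proof.
elim: n => [|n IH]; first by rewrite leqn0 => /eqP ->.
rewrite leq_eqVlt => /predU1P[->//|/IH h]; apply: le_trans h _.
rewrite lef_pV2 ?posrE ?abs_fact_gt0 // -abs_factS ler_piMl ?(usn_ge0 hv) //.
exact: (usn_nat hv).
Qed.

Lemma ode_abs_le (q : {poly F}) n : (forall i, v q`_i <= 1) ->
  v (ode q n) <= (v n`!%:R)^-1.
Proof.
move=> hq; elim/ltn_ind: n => [[|n] IH].
  by rewrite ode0 (abs1 vM v_eq0) invr1.
rewrite -abs_factS invfM mulrC ler_pdivlMr ?(abs_gt0 hv v_eq0) ?nz //.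
rewrite mulrC -vM odeS //; apply: (usn_sum_le hv) => [|j _].
  by rewrite invr_ge0 (usn_ge0 hv).
apply: (usnMl_le1 hv) => //; apply: le_trans (IH _ _) _; rewrite ?ltnS ?leq_subr //.
by apply: abs_fact_anti; rewrite leq_subr.
Qed.

(** The loss [1 / |n!|] comes from the divisions in the recursion; it dictates the precision [|n!|]
    asked of the Lubin-Tate approximation. *)
Lemma ode_abs_close (q q' : {poly F}) (e : R) n : 0 <= e ->
  (forall i, v q`_i <= 1) -> (forall i, v q'`_i <= 1) ->
  (forall i, v (q`_i - q'`_i) <= e) ->
  v (ode q n - ode q' n) <= e * (v n`!%:R)^-1.
Proof.
move=> e0 hq hq' hqq; elim/ltn_ind: n => [[|n] IH].
  by rewrite !ode0 subrr (usn0 hv) mulr_ge0 ?invr_ge0 ?(usn_ge0 hv).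
rewrite -abs_factS invfM [_ * (v n`!%:R)^-1]mulrC mulrA ler_pdivlMr ?(abs_gt0 hv v_eq0) ?nz //.
rewrite mulrC -vM mulrBr !odeS // -sumrB; apply: (usn_sum_le hv) => [|j _].
  by rewrite mulr_ge0 ?invr_ge0 ?(usn_ge0 hv).
have -> : q`_j * ode q (n - j) - q'`_j * ode q' (n - j) =
  q`_j * (ode q (n - j) - ode q' (n - j)) + (q`_j - q'`_j) * ode q' (n - j) by ring.
have anti : (v (n - j)`!%:R)^-1 <= (v n`!%:R)^-1 by apply: abs_fact_anti; rewrite leq_subr.
apply: (usnD_le hv).
  apply: (usnMl_le1 hv) => //; apply: le_trans (IH _ _) _; rewrite ?ltnS ?leq_subr //.
  exact: ler_wpM2l.
apply: (usnM_le hv) => //; exact: le_trans (ode_abs_le _ hq') _.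
Qed.

(** The logarithmic derivative of [exp (\sum_(l < K) a_l Y^(p^l) / p^l)], in which the denominators
    have cancelled. *)
Definition expo_q (a : nat -> F) K : {poly F} := \sum_(l < K) a l *: 'X^((p ^ l).-1).

Lemma abs_expo_q_le (a : nat -> F) K (e : R) i : 0 <= e ->
  (forall l, v (a l) <= e) -> v (expo_q a K)`_i <= e.
Proof.
move=> e0 ha; rewrite coef_sum; apply: (usn_sum_le hv) => // l _.
rewrite coefZ; apply: (usnMr_le1 hv) => //; rewrite coefXn; exact: (usn_nat hv).
Qed.

Lemma expo_qB (a b : nat -> F) K :
  expo_q a K - expo_q b K = expo_q (fun l => a l - b l) K.
Proof. by rewrite /expo_q -sumrB; apply: eq_bigr => l _; rewrite scalerBl. Qed.

Lemma expo_q_size (a : nat -> F) K : (size (expo_q a K.+1) <= (p ^ K).-1.+1)%N.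
Proof.
apply: leq_trans (size_sum _ _ _) _; apply/bigmax_leqP => l _.
apply: leq_trans (size_scale_leq _ _) _; rewrite size_polyXn ltnS.
have : (p ^ l <= p ^ K)%N by rewrite leq_pexp2l ?prime_gt0 // -ltnS.
lia.
Qed.

Lemma dwork_horner T K x n :
  (ode (dwork_q p T K) n).[x] = ode (expo_q (fun l => (LTiter T l).[x]) K) n.
Proof.
elim/ltn_ind: n => [[|n] IH]; first by rewrite !ode0 hornerC.
apply: (mulfI (nz n)); rewrite odeS //.
have -> : n.+1%:R * (ode (dwork_q p T K) n.+1).[x] =
  (n.+1%:R * ode (dwork_q p T K) n.+1).[x] by rewrite -polyC_natr hornerCM.
rewrite odeS; last exact: poly_nat_unit.
rewrite horner_sum; apply: eq_bigr => j _; rewrite hornerM IH ?ltnS ?leq_subr //.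
congr (_ * _); rewrite /dwork_q /expo_q !coef_sum horner_sum; apply: eq_bigr => l _.
by rewrite coefCM coefZ hornerM !coefXn -polyC_natr hornerC.
Qed.

(** [Pi] is [0, pi_0, pi_1, ...]; [T] approximates the Lubin-Tate series. *)
Definition LT_approx (Pi : nat -> F) := forall (e : R) (M : nat), 0 < e ->
  exists T c : {poly F}, [/\ coefs_in (Zloc p) T, coefs_in (Zloc p) c,
    'X^p - T = p%:R * c & forall j, (j <= M)%N -> v (T.[Pi j] - Pi j.-1) <= e].

(** Dwork's lemma holds with the iterates [T^(l)] as coefficients; evaluation at [X = Pi m] stays
    integral. The values [T^(l) (Pi m)] are close to [Pi (m - l)] because integral polynomials are
    1-Lipschitz on the unit disc. *)
Lemma LT_exp_integral (Pi : nat -> F) m n :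
  Pi 0%N = 0 -> (forall j, v (Pi j) <= 1) -> LT_approx Pi ->
  v (ode (expo_q (fun l => Pi (m - l)%N) m) n) <= 1.
Proof.
(* As [Pi 0 = 0], the terms with [l >= m] vanish, so the sum may be lengthened until [n < p ^ K], as
   Dwork's lemma requires. *)
move=> Pi0 hPi hT; set K := (m + n)%N.
have qE : expo_q (fun l => Pi (m - l)%N) m = expo_q (fun l => Pi (m - l)%N) K.
  rewrite /expo_q /K big_split_ord /= [X in _ + X]big1 ?addr0 // => l _.
  by rewrite subnDA subnn sub0n Pi0 scale0r.
have [T [c [CT Cc hc hj]]] := hT (v n`!%:R) m (abs_fact_gt0 n).
have vT i : v T`_i <= 1 by apply: abs_Zloc; apply: CT.
have it l : forall x, (LTiter T l).[x] = iter l (horner T) x.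
  elim: l => [|l IH] x; first by rewrite /LTiter hornerX.
  by rewrite /LTiter iterS horner_comp -/(LTiter T l) IH -iterSr.
have it1 l : v (LTiter T l).[Pi m] <= 1.
  by rewrite it; elim: l => //= l IH; apply: abs_horner.
have close l : v ((LTiter T l).[Pi m] - Pi (m - l)%N) <= v n`!%:R.
  rewrite it; elim: l => [|l IH].
    by rewrite subn0 subrr (usn0 hv) (usn_ge0 hv).
  rewrite /= subnS -(subrK T.[Pi (m - l)%N] (horner _ _)) -addrA.
  apply: (usnD_le hv); last by apply: hj; rewrite leq_subr.
  by apply: le_trans IH; apply: abs_horner_lip => //; rewrite -it.
rewrite qE; set q := expo_q _ K.
pose q' := expo_q (fun l => (LTiter T l).[Pi m]) K.
rewrite -(subrK (ode q' n) (ode q n)); apply: (usnD_le hv).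
  apply: le_trans (ode_abs_close n (usn_ge0 hv n`!%:R) _ _ _) _.
  - by move=> i; apply: abs_expo_q_le.
  - by move=> i; apply: abs_expo_q_le.
  - move=> i; rewrite -coefB expo_qB; apply: abs_expo_q_le; rewrite ?(usn_ge0 hv) // => l.
    by rewrite -(absN hv) opprB.
  by rewrite mulfV // gt_eqF ?abs_fact_gt0.
rewrite -dwork_horner; apply: abs_horner => // i; apply: abs_Zloc.
move: i; apply: (dwork_integral pp nz Cc hc); rewrite /K.
apply: leq_ltn_trans (leq_addl m n) _; apply: ltn_expl; exact: prime_gt1.
Qed.

(** * Taylor coefficients of a solution, divided by the solution *)

Section TaylorCoef.
Variable q : {poly F}.

(** The coefficient of [d^k] in [E (Y + d) / E Y], for [E' = q E]. *)
Definition taylor_coef k : {poly F} := k`!%:R^-1 *: dconn (@deriv F) q k.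

Lemma taylor_coefE k : k`!%:R *: taylor_coef k = dconn (@deriv F) q k.
Proof. by rewrite scalerA mulfV ?scale1r // natF_gt0_neq0 ?fact_gt0. Qed.

Lemma deriv_taylor_coef k :
  (taylor_coef k)^`() = k.+1%:R * taylor_coef k.+1 - q * taylor_coef k.
Proof.
have h1 : k.+1%:R != 0 :> F := nz k.
have h2 : k`!%:R != 0 :> F by rewrite natF_gt0_neq0 ?fact_gt0.
rewrite /taylor_coef derivZ dconnS factS natrM invfM -[k.+1%:R]polyC_natr mul_polyC scalerA.
by rewrite mulrA divff // mul1r scalerDr -scalerAr [q * _]mulrC addrK.
Qed.

Lemma taylor_coef_size M k : (size q <= M.+1)%N -> (size (taylor_coef k) <= (k * M).+1)%N.
Proof.
move=> sq; apply: leq_trans (size_scale_leq _ _) _.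
elim: k => [|k IH]; first by rewrite dconn0 size_poly1.
rewrite dconnS; apply: leq_trans (size_polyD _ _) _; rewrite geq_max; apply/andP; split.
  apply: leq_trans (_ : _ <= (k * M).+1)%N _; last by rewrite ltnS leq_mul.
  by apply: leq_trans IH; apply: leq_trans (size_poly _ _) (leq_pred _).
apply: leq_trans (size_polyMleq _ _) _.
have := leq_add IH sq; rewrite mulSn; set a := size _; set b := size _; lia.
Qed.

Lemma taylor_coef_ode N k :
  eqX (N - k) (odep q N)^`(k) (dconn (@deriv F) q k * odep q N).
Proof.
elim: k => [|k IH]; first by rewrite dconn0 mul1r derivn0.
case: (ltnP k N) => [hk|hk]; last by move=> i; rewrite (eqP (leqW hk : (N - k.+1 == 0)%N)).
rewrite derivnS dconnS; apply: (@eqX_trans _ _ _ (dconn (@deriv F) q k * odep q N)^`()).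
  by apply: eqX_deriv; rewrite subnSK.
rewrite derivM mulrDl -mulrA; apply: eqXD => //; apply: eqXM => //.
apply: (eqX_le (leq_subr k.+1 N)); exact: odep_deriv.
Qed.

(** The product of [taylor_coef k] with [E] is the divided derivative [E^(k) / k!], which is
    integral; dividing by [E], whose constant term is [1], keeps this by induction on the degree. *)
Lemma taylor_coef_integral : (forall n, v (ode q n) <= 1) ->
  forall k n, v (taylor_coef k)`_n <= 1.
Proof.
move=> hq k n; elim/ltn_ind: n => n IH.
have f0 := natF_gt0_neq0 (fact_gt0 k); set N := (n + k).+1.
have h : (taylor_coef k * odep q N)`_n = (odep q N)^`N(k)`_n.
  apply: (mulfI f0); rewrite -coefZ scalerAl taylor_coefE mulr_natl -coefMn -nderivn_def.
  by rewrite taylor_coef_ode // /N subSn ?leq_addl // addnK.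
move: h; rewrite coefM big_ord_recr /= subnn [(odep q N)`_0]coef_poly /= ode0 mulr1.
move=> /(canRL (addKr _)) ->; rewrite addrC; apply: (usnB_le hv).
  rewrite coef_nderivn; apply: (usnMn_le hv); rewrite coef_poly.
  by case: ifP => _; rewrite ?(usn0 hv).
apply: (usn_sum_le hv) => // j _; apply: (usnMl_le1 hv); first exact: IH.
by rewrite coef_poly; case: ifP => _; rewrite ?(usn0 hv).
Qed.

End TaylorCoef.
End LubinTateExp.

(** * Radii of the factors and of their quotients *)

Lemma bernoulli_le (R : realFieldType) (h : R) n : 0 <= h -> 1 + n%:R * h <= (1 + h) ^+ n.
Proof.
move=> h0; elim: n => [|n IH]; first by rewrite mul0r addr0 expr0.
rewrite exprS -natr1; have : 0 <= n%:R :> R by [].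
move: IH; set x := n%:R; set y := _ ^+ n => h1 h2.
have h3 : 0 <= x * h by rewrite mulr_ge0.
nra.
Qed.

Lemma expr_le_small (R : archiRealFieldType) (d e : R) : 0 <= d -> d < 1 -> 0 < e ->
  exists n, d ^+ n <= e.
Proof.
move=> d0 d1 e0; have [->|dn0] := eqVneq d 0; first by exists 1%N; rewrite expr1 ltW.
have dp : 0 < d by rewrite lt0r dn0.
pose h := d^-1 - 1; have h0 : 0 < h by rewrite subr_gt0 invf_gt1.
exists (Num.bound (e^-1 / h)).
suff : e^-1 <= d^-1 ^+ Num.bound (e^-1 / h) by rewrite exprVn lef_pV2 ?posrE ?exprn_gt0.
have -> : d^-1 = 1 + h by rewrite /h; ring.
apply: le_trans (bernoulli_le _ (ltW h0)).
have eh0 : 0 <= e^-1 / h by rewrite divr_ge0 ?invr_ge0 ?(ltW e0) ?(ltW h0).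
have := archi_boundP eh0.
by rewrite ltr_pdivrMr // => /ltW H; apply: le_trans H _; rewrite lerDr.
Qed.

(** [d/dT] in terms of [Z = T^-1]. *)
Definition derT (F : nzRingType) (s : {poly F}) : {poly F} := - ('X^2 * s^`()).

Section DerT.
Variable F : comNzRingType.
Implicit Types s t : {poly F}.

Lemma derTD : {morph @derT F : s t / s + t}.
Proof. by move=> s t; rewrite /derT derivD mulrDr opprD. Qed.

Lemma derTM s t : derT (s * t) = derT s * t + s * derT t.
Proof. by rewrite /derT derivM; ring. Qed.

Lemma derTZ c s : derT (c *: s) = c *: derT s.
Proof. by rewrite /derT derivZ -scalerAr scalerN. Qed.

Lemma derT_comp s t : derT (s \Po t) = (s^`() \Po t) * derT t.
Proof. by rewrite /derT deriv_comp; ring. Qed.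

Lemma coef_derT s n : (derT s)`_n = - (n.-1%:R * s`_n.-1).
Proof.
rewrite /derT coefN coefXnM coef_deriv; case: n => [|[|n]] /=; rewrite ?mul0r //.
by rewrite subn2 /= mulr_natl.
Qed.

(** The [j]-th derivative of [T^-m] is [(-1)^j m (m+1) ... (m+j-1) T^(-m-j)]; with [n = m + j] the
    product is a falling factorial of [n - 1]. For [n < j] that factorial is zero, so the truncated
    [n - j] is harmless. *)
Lemma coef_iter_derT j s n :
  (iter j (@derT F) s)`_n = (-1) ^+ j * (n.-1 ^_ j)%:R * s`_(n - j).
Proof.
elim: j n => [|j IH] n; first by rewrite expr0 ffactn0 !mul1r subn0.
rewrite iterS coef_derT IH ffactnS natrM exprS.
have -> : (n - j.+1 = n.-1 - j)%N by lia.
by ring.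
Qed.

End DerT.

Section Blocks.
Variables (R : archiRealFieldType) (F : fieldType) (v : F -> R) (p : nat).
Hypotheses (hv : ultra_seminorm v) (vM : {morph v : x y / x * y}).
Hypotheses (v_eq0 : forall x, v x = 0 -> x = 0).
Hypotheses (pp : prime p) (vp : v p%:R = p%:R^-1).
Variable t : R.
Hypothesis t1 : 1 <= t.

Let nz := natF_neq0 hv vM v_eq0 pp vp.
Let t0 : 0 <= t := le_trans ler01 t1.
Let S : comNzRingType := {poly F}.
Let N : S -> R := gauss v t.
Let hN : ultra_seminorm N := gauss_seminorm hv t0.
Let D : S -> S := @derT F.

Lemma gaussZ c (s : S) : N (c *: s) <= v c * N s.
Proof. by rewrite -mul_polyC; apply: (usnM_le hN) => //; apply: gaussC. Qed.

Definition derT_div j (s : {poly F}) : {poly F} := j`!%:R^-1 *: iter j D s.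

Let f0 j : j`!%:R != 0 :> F.
Proof. by case: (j`!) (fact_gt0 j). Qed.

Lemma derT_divS j s : j.+1%:R *: derT_div j.+1 s = D (derT_div j s).
Proof.
rewrite /derT_div /D derTZ factS natrM invfM scalerA mulrA.
by rewrite divff ?mul1r.
Qed.

(** Division by [j!] turns the falling factorial into a binomial coefficient, so nothing is lost. *)
Lemma gauss_derT_div j s : N (derT_div j s) <= t ^+ j * N s.
Proof.
apply: gauss_le => [|n]; first by rewrite mulr_ge0 ?exprn_ge0 ?(usn_ge0 hN).
rewrite coefZ coef_iter_derT -bin_ffact natrM.
have [hj|hj] := ltnP n j.
  rewrite bin_small ?mul0r ?mulr0 ?mul0r ?mulr0 ?(usn0 hv) ?mul0r ?mulr_ge0 ?exprn_ge0 ?(usn_ge0 hN) //.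
  by apply: leq_ltn_trans (leq_pred _) hj.
have -> : j`!%:R^-1 * ((-1) ^+ j * ('C(n.-1, j)%:R * j`!%:R) * s`_(n - j)) =
   (-1) ^+ j * ('C(n.-1, j)%:R * s`_(n - j)) :> F.
  by field.
have -> : t ^+ n = t ^+ j * t ^+ (n - j) by rewrite -exprD subnKC.
rewrite mulrCA; apply: ler_wpM2l; rewrite ?exprn_ge0 //.
apply: le_trans (gauss_coef hv t0 s (n - j)); rewrite ler_wpM2r ?exprn_ge0 //.
apply: (usnMl_le1 hv); last by apply: (usnMl_le1 hv) => //; apply: (usn_nat hv).
by rewrite -(expr1n R j); apply: (usnX_le hv); rewrite (absN hv) (usn1 hv).
Qed.

Lemma gauss_derT s : N (D s) <= t * N s.
Proof. by have := gauss_derT_div 1 s; rewrite /derT_div invr1 scale1r expr1. Qed.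

Lemma gauss_iter_derT j s : N (iter j D s) <= v j`!%:R * (t ^+ j * N s).
Proof.
have -> : iter j D s = j`!%:R *: derT_div j s by rewrite scalerA divff ?scale1r.
apply: le_trans (gaussZ _ _) _; apply: ler_wpM2l; first exact: (usn_ge0 hv).
exact: gauss_derT_div.
Qed.

Variables (q : {poly F}) (M : nat) (a : R).
Hypotheses (sq : (size q <= M.+1)%N) (qint : forall n, v (ode q n) <= 1).
Hypotheses (qint1 : forall i, v q`_i <= 1) (a1 : 1 <= a).

Let a0 : 0 <= a := le_trans ler01 a1.

Let c k := taylor_coef q k.

Let c_comp A k : N A <= a -> N (c k \Po A) <= a ^+ (k * M).
Proof.
move=> hA; apply: (usn_comp_poly_le hN) => //; first exact: gaussC.
  by move=> i; apply: (taylor_coef_integral hv vM v_eq0 pp vp).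
exact: taylor_coef_size.
Qed.

Let c0 A : c 0%N \Po A = 1.
Proof. by rewrite /c /taylor_coef fact0 invr1 scale1r dconn0 comp_polyC. Qed.

Let derT_c A k : D (c k \Po A) =
  (k.+1%:R * (c k.+1 \Po A) - (q \Po A) * (c k \Po A)) * D A.
Proof.
rewrite /D derT_comp (deriv_taylor_coef hv vM v_eq0 pp vp).
by rewrite rmorphB !rmorphM /= -[k.+1%:R in LHS]polyC_natr comp_polyC polyC_natr.
Qed.

Section Block.
Variables (A : {poly F}) (r : R) (n : nat).
Hypotheses (hA : N A <= a) (r0 : 0 < r) (hr : r * t * a ^+ M.+1 <= 1).

Let SX : comNzRingType := {poly {poly F}}.
Let G : {poly S} -> R := gauss N r.
Let hG : ultra_seminorm G := gauss_seminorm hN (ltW r0).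

(** [A(T + x)] is annihilated by the derivation [d/dx - d/dT]. *)
Let th (P : SX) : SX := P^`() - (- 'X^2 : S)%:P * map_poly (@deriv F) P.

Let thD : {morph th : P Q / P + Q}.
Proof. by move=> P Q; rewrite /th derivD raddfD /=; ring. Qed.

Let map_derivM (P Q : SX) : map_poly (@deriv F) (P * Q) =
  map_poly (@deriv F) P * Q + P * map_poly (@deriv F) Q.
Proof.
apply/polyP => i; rewrite coefD coef_map !coefM /= raddf_sum -big_split /=.
by apply: eq_bigr => j _; rewrite /= derivM !coef_map.
Qed.

Let thM P Q : th (P * Q) = th P * Q + P * th Q.
Proof. by rewrite /th derivM map_derivM; ring. Qed.

Let thC s : th s%:P = - (D s)%:P.
Proof. by rewrite /th derivC map_polyC /= -polyCM sub0r /D /derT mulNr. Qed.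

Let coef_th P i : (th P)`_i = i.+1%:R * P`_i.+1 - D P`_i.
Proof.
by rewrite /th coefB coef_deriv coefCM coef_map /= mulr_natl /D /derT mulNr.
Qed.

(** [A(T + x) - A(T)], modulo [x ^ n.+1]. *)
Let Dl : SX := \poly_(j < n.+1) (if j == 0%N then 0 else derT_div j A).

(** Modulo [x ^ n.+1] this is [u (T + x) / u (T)] with [u = E (A)]. *)
Let W : SX := \sum_(k < n.+1) (c k \Po A)%:P * Dl ^+ k.

Let thDl : eqX n (- (D A)%:P + th Dl) 0.
Proof.
move=> i hi; rewrite coefD coefN coefC coef_th !coef_poly coef0 ltnS hi ltnS (ltnW hi) /=.
case: i hi => [|i] hi /=.
  rewrite mul1r /derT_div /= invr1 scale1r (der0 (D := D) (@derTD F)) subr0.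
  by rewrite addNr.
by rewrite oppr0 add0r -derT_divS -[i.+2%:R]polyC_natr mul_polyC subrr.
Qed.

Let Dln : eqX n (Dl ^+ n) 0.
Proof.
have -> : Dl = 'X * \poly_(j < n) derT_div j.+1 A.
  apply/polyP => -[|i]; rewrite coefXM !coef_poly //=.
by rewrite exprMn; apply: eqX_XnM.
Qed.

(** The derivation [th] kills [u (T + x)] and sends [1 / u (T)] to [(D u / u) / u]. *)
Let thW : eqX n (th W) (((q \Po A) * D A)%:P * W).
Proof.
(* On constants [th] is [- D], hence [b = - D A]. The error terms contain [b + th Dl] and [Dl ^+ n],
   both zero modulo [x^n]. *)
rewrite /W (der_taylor_trunc thD thM (C := fun k => (c k \Po A)%:P)
  (q := (q \Po A)%:P) (b := - (D A)%:P)); last first.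
  by move=> k; rewrite thC derT_c polyCM polyCB !polyCM polyC_natr; ring.
rewrite -/W -[X in eqX _ _ X]addr0 -[X in eqX _ _ X]addr0.
apply: eqXD; first apply: eqXD.
- by move=> i _; rewrite mulrN mulNr opprK -polyCM.
- by rewrite -[X in eqX _ _ X](mul0r (\sum_(k < n) k.+1%:R * (c k.+1 \Po A)%:P * Dl ^+ k)); apply: eqXM.
rewrite -mulrA mulrC -mulrA -[X in eqX _ _ X](mul0r (- (D A)%:P * (n.+1%:R * (c n.+1 \Po A)%:P))).
exact: eqXM.
Qed.

Let W0 : W`_0 = 1.
Proof.
rewrite /W big_ord_recl expr0 mulr1 coefD coefC /= c0 coef_sum big1 ?addr0 // => k _.
by rewrite coefCM -horner_coef0 horner_exp horner_coef0 coef_poly /= expr0n mulr0.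
Qed.

(** Read coefficientwise, [thW] is the recursion that defines [dconn]. *)
Let W_dconn j : (j <= n)%N -> j`!%:R * W`_j = dconn D ((q \Po A) * D A) j.
Proof.
elim: j => [|j IH] hj; first by rewrite W0 mulr1.
rewrite dconnS -(IH (ltnW hj)).
rewrite factS.
rewrite natrM.
have := thW hj; rewrite coef_th coefCM => /(canRL (subrK _)) e.
rewrite -mulrA mulrCA e mulrDr -[j`!%:R]polyC_natr mul_polyC mul_polyC.
by rewrite mul_polyC [D (_ *: _)]derTZ -scalerAl addrC [W`__ * _]mulrC.
Qed.

Let rt0 : 0 <= r * t. Proof. by rewrite mulr_ge0 ?(ltW r0). Qed.
Let rt1 : r * t <= 1.
Proof. by apply: le_trans hr; apply: ler_peMr => //; apply: exprn_ege1. Qed.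

Let GDl : G Dl <= r * t * a.
Proof.
apply: gauss_le => [|[|j]]; first by rewrite mulr_ge0.
  by rewrite coef_poly /= (usn0 hN) mul0r mulr_ge0.
rewrite coef_poly /=; case: ifP => _; last by rewrite (usn0 hN) mul0r mulr_ge0.
apply: le_trans (ler_wpM2r (exprn_ge0 _ (ltW r0)) (gauss_derT_div j.+1 A)) _.
rewrite mulrAC -exprMn [t * r]mulrC; apply: ler_pM => //; rewrite ?exprn_ge0 ?(usn_ge0 hN) //.
by rewrite exprS; apply: ler_piMr => //; apply: exprn_ile1.
Qed.

Let GW : G W <= 1.
Proof.
apply: (usn_sum_le hG) => // k _.
apply: le_trans (usnM_le hG (M := a ^+ (k * M)) (M' := (r * t * a) ^+ k) _ _) _.
- by apply: le_trans (gaussC r hN _) _; apply: c_comp.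
- exact: (usnX_le hG).
rewrite mulnC exprM -exprMn.
have -> : (a ^+ M * (r * t * a)) = r * t * a ^+ M.+1 by rewrite exprS; ring.
by apply: exprn_ile1 => //; rewrite mulr_ge0 ?exprn_ge0.
Qed.

(** A Cauchy estimate. On the disc of radius [r] the increment of [A] has norm at most [r t a], and
    the coefficient of its [k]-th power at most [a^(k M)]; by [hr] the series [W] is bounded by [1],
    and its [n]-th coefficient is [g_[n] / n!]. *)
Lemma gauss_dconn_block :
  N (dconn D ((q \Po A) * D A) n) <= v n`!%:R * r ^- n.
Proof.
rewrite -W_dconn // -[n`!%:R]polyC_natr mul_polyC.
apply: le_trans (gaussZ _ _) _; apply: ler_wpM2l; first exact: (usn_ge0 hv).
rewrite -[_ ^- _]mul1r ler_pdivlMr ?exprn_gt0 //.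
exact: le_trans (gauss_coef hN (ltW r0) W n) GW.
Qed.

End Block.

(** * Quotient of the solutions attached to two nearby polynomials *)

Section Comparison.
Variables (A B : {poly F}) (e d : R).
Hypotheses (hA : N A <= a) (hB : N B <= a) (hAB : N (A - B) <= e).
Hypotheses (hd : e * a ^+ M <= d) (d1 : d < 1).

Let e0 : 0 <= e. Proof. exact: le_trans (usn_ge0 hN _) hAB. Qed.
Let d0 : 0 <= d. Proof. by apply: le_trans hd; rewrite mulr_ge0 ?exprn_ge0. Qed.

Let g := (q \Po A) * D A - (q \Po B) * D B.
(** A truncation of [E A / E B], a solution of [D u = g u] up to [d ^ n]. *)
Let w n := \sum_(k < n.+1) (c k \Po B) * (A - B) ^+ k.

Let cX_le k : N ((c k \Po B) * (A - B) ^+ k) <= d ^+ k.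
Proof.
apply: le_trans (usnM_le hN (M := a ^+ (k * M)) (M' := e ^+ k) (c_comp k hB) (usnX_le hN k hAB)) _.
rewrite mulnC exprM -exprMn mulrC; apply: lerXn2r; rewrite ?nnegrE //.
by rewrite mulr_ge0 ?exprn_ge0.
Qed.

Let w1 n : N (w n - 1) <= d.
Proof.
rewrite /w big_ord_recl c0 mul1r expr0 addrC addKr.
apply: (usn_sum_le hN) => // k _; rewrite /= /bump add1n; apply: le_trans (cX_le _) _.
by rewrite exprS; apply: ler_piMr => //; apply: exprn_ile1 => //; apply: ltW.
Qed.

Let q_le : N (q \Po A) <= a ^+ M.
Proof. by apply: (usn_comp_poly_le hN) => //; apply: gaussC. Qed.

(** A truncation of [E' (A) / E B], to be compared with [q (A)] times [E A / E B]. *)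
Let V n := \sum_(k < n) k.+1%:R * (c k.+1 \Po B) * (A - B) ^+ k.

Let taylor_q : q \Po A = \sum_(j < size q) (q^`N(j) \Po B) * (A - B) ^+ j.
Proof.
rewrite /comp_poly -{1}(subrK B A) addrC nderiv_taylor; last exact: mulrC.
by rewrite size_map_polyC; apply: eq_bigr => j _; rewrite nderivn_map.
Qed.

(** The [k]-th derivative of [E' = q E], divided by [k! E]. *)
Let c_leibniz k : k.+1%:R * c k.+1 = \sum_(j < k.+1) q^`N(j) * c (k - j).
Proof.
have fk := f0 k; apply: (@scalerI _ _ k`!%:R) => //.
have -> : k`!%:R *: (k.+1%:R * c k.+1) = dconn (@deriv F) q k.+1.
  rewrite -(taylor_coefE hv vM v_eq0 pp vp) factS natrM mulrC -scalerA.
  by rewrite -[k.+1%:R]polyC_natr mulrC mul_polyC scalerA mulrC -scalerA.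
rewrite (dconn_leibniz (@derivD F) (@derivM F)) scaler_sumr; apply: eq_bigr => j _.
have -> : iter j (@deriv F) q = q^`(j) by [].
rewrite nderivn_def -(taylor_coefE hv vM v_eq0 pp vp) mulrnAl -mulrnA -scalerAr.
rewrite -scaler_nat scalerA -natrM; congr (_ *: _).
have hj : (j <= k)%N by rewrite -ltnS.
by rewrite -(bin_fact hj); congr (_%:R); lia.
Qed.

Let V_err n : N (V n - (q \Po A) * w n) <= a ^+ M * d ^+ n.
Proof.
(* The product of series [(q (B + x)) (\sum_k c_k x^k)], to be evaluated at [x = A - B]. *)
pose Qx : {poly S} := \poly_(j < size q) (q^`N(j) \Po B).
pose Cx : {poly S} := \poly_(k < n.+1) (c k \Po B).
pose E : {poly S} := \poly_(k < n) (k.+1%:R * (c k.+1 \Po B)) - Qx * Cx.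
have -> : V n - (q \Po A) * w n = E.[A - B].
  by rewrite /E hornerD hornerN hornerM !horner_poly taylor_q.
have E0 k : (k < n)%N -> E`_k = 0.
  move=> hk; rewrite /E coefB coef_poly hk coefM.
  rewrite -[k.+1%:R]polyC_natr -(comp_polyC _ B) -rmorphM /= polyC_natr c_leibniz rmorph_sum.
  rewrite -sumrB big1 // => j _; rewrite rmorphM /= !coef_poly.
  rewrite (leq_ltn_trans (leq_subr _ _)) ?(ltnW hk) //; last by rewrite ltnS ltnW.
  case: ltnP => hj; first by rewrite subrr.
  by rewrite nderivn_poly0 // rmorph0 !mul0r subrr.
(* For this radius [Cx] has norm at most [1], since [c k \Po B] has norm at most [a^(k M)]; moreover
   [N (A - B) <= d * rho], so degree [k] contributes a factor [d^k]. *)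
pose rho := a ^- M; have rho0 : 0 <= rho by rewrite invr_ge0 exprn_ge0.
have rho1 : rho <= 1 by rewrite invf_le1 ?exprn_ege1 ?exprn_gt0 ?(lt_le_trans ltr01).
have hG := gauss_seminorm hN rho0.
have GE : gauss N rho (Qx * Cx) <= a ^+ M.
  apply: (usnMr_le1 hG).
    apply: gauss_le => [|i]; rewrite ?exprn_ge0 // coef_poly.
    case: ifP => _; last by rewrite (usn0 hN) mul0r exprn_ge0.
    rewrite -[a ^+ M]mulr1; apply: ler_pM; rewrite ?exprn_ge0 ?(usn_ge0 hN) ?exprn_ile1 //.
    apply: (usn_comp_poly_le hN) => //; first exact: gaussC.
      by move=> l; rewrite coef_nderivn; apply: (usnMn_le hv).
    by apply: leq_trans (size_poly _ _) _; apply: leq_trans (leq_subr _ _) _.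
  apply: gauss_le => // i; rewrite coef_poly.
  case: ifP => _; last by rewrite (usn0 hN) mul0r.
  apply: le_trans (ler_wpM2r (exprn_ge0 _ rho0) (c_comp i hB)) _.
  by rewrite /rho exprVn mulnC exprM divff // !expf_neq0 // gt_eqF // (lt_le_trans ltr01).
rewrite horner_coef; apply: (usn_sum_le hN) => [|k _]; first by rewrite mulr_ge0 ?exprn_ge0.
have [hk|hk] := ltnP k n; first by rewrite E0 // mul0r (usn0 hN) mulr_ge0 ?exprn_ge0.
have -> : E`_k = - (Qx * Cx)`_k by rewrite /E coefB coef_poly ltnNge hk sub0r.
have hrho : a ^+ M * rho = 1 by rewrite divff // expf_neq0 // gt_eqF // (lt_le_trans ltr01).
apply: (@le_trans _ _ (a ^+ M * d ^+ k)); last first.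
  apply: ler_wpM2l; first exact: exprn_ge0.
  by apply: ler_wiXn2l => //; apply: ltW.
apply: le_trans (usnM_le hN (usnN hN _) (usnX_le hN k hAB)) _.
have -> : N (Qx * Cx)`_k * e ^+ k = N (Qx * Cx)`_k * rho ^+ k * (e * a ^+ M) ^+ k.
  by rewrite -mulrA -exprMn mulrCA [rho * _]mulrC hrho mulr1.
apply: ler_pM; rewrite ?mulr_ge0 ?exprn_ge0 ?mulr_ge0 ?exprn_ge0 ?(usn_ge0 hN) //.
  exact: le_trans (gauss_coef hN rho0 (Qx * Cx) k) GE.
by apply: lerXn2r; rewrite ?nnegrE ?mulr_ge0 ?exprn_ge0.
Qed.

Let K := t * a * a ^+ M.

Let w_err n : N (D (w n) - g * w n) <= K * d ^+ n.
Proof.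
rewrite /w (der_taylor_trunc (D := D) (@derTD F) (@derTM F) (C := fun k => c k \Po B)
  (q := q \Po B) (b := D B)); last by move=> k; apply: derT_c.
have -> : D B + D (A - B) = D A by rewrite [D (A - B)](derB (@derTD F)) addrC subrK.
rewrite -/(w n) -/(V n).
have -> : - ((q \Po B) * D B * w n) + D A * V n +
     n.+1%:R * (c n.+1 \Po B) * (A - B) ^+ n * D B - g * w n =
   D A * (V n - (q \Po A) * w n) +
     n.+1%:R * ((c n.+1 \Po B) * (A - B) ^+ n * D B) by rewrite /g; ring.
apply: (usnD_le hN).
  have -> : K * d ^+ n = (t * a) * (a ^+ M * d ^+ n) by rewrite /K; ring.
  by apply: (usnM_le hN) => //; apply: le_trans (gauss_derT _) _; apply: ler_wpM2l.
apply: (usnMl_le1 hN); first exact: (usn_nat hN).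
apply: le_trans (usnM_le hN (usnM_le hN (c_comp n.+1 hB) (usnX_le hN n hAB)) (gauss_derT B)) _.
have -> : a ^+ (n.+1 * M) * e ^+ n * (t * N B) = (e * a ^+ M) ^+ n * (a ^+ M * (t * N B)).
  by rewrite mulSn exprD [(n * M)%N]mulnC exprM exprMn; ring.
have -> : K * d ^+ n = d ^+ n * (a ^+ M * (t * a)) by rewrite /K; ring.
apply: ler_pM; rewrite ?exprn_ge0 ?mulr_ge0 ?exprn_ge0 ?(usn_ge0 hN) //.
  by apply: lerXn2r; rewrite ?nnegrE ?mulr_ge0 ?exprn_ge0.
by rewrite !ler_wpM2l ?exprn_ge0.
Qed.

(** The constant depends on [i] but not on [n], so for fixed [i] the error tends to [0]. *)
Let iter_err i : exists2 C, 0 <= C &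
  forall n, N (iter i D (w n) - dconn D g i * w n) <= C * d ^+ n.
Proof.
elim: i => [|i [C C0 IH]].
  by exists 0 => // n; rewrite dconn0 mul1r subrr (usn0 hN) mul0r.
exists (Num.max (t * C) (N (dconn D g i) * K)).
  by rewrite le_max mulr_ge0.
move=> n; rewrite dconnS iterS.
have -> : D (iter i D (w n)) - (D (dconn D g i) + dconn D g i * g) * w n =
    D (iter i D (w n) - dconn D g i * w n) + dconn D g i * (D (w n) - g * w n).
  by rewrite [D (_ - _)](derB (D := D) (@derTD F)) [D (_ * w n)](derTM _ (w n)) /D; ring.
rewrite maxr_pMl ?exprn_ge0 //; apply: le_trans (usnD hN _ _) _.
rewrite ge_max !le_max; apply/andP; split; apply/orP; [left|right].
  by apply: le_trans (gauss_derT _) _; rewrite -mulrA; apply: ler_wpM2l.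
by rewrite -mulrA; apply: (usnM_le hN).
Qed.

(** If [w] were an exact solution, [dconn D g i] would be [D^i w / w], and [w] has norm at most [1].
    Dividing by [w] is avoided: [w] is within [d < 1] of [1], so the correction is absorbed. *)
Lemma gauss_dconn_comparison i :
  N (dconn D ((q \Po A) * D A - (q \Po B) * D B) i) <= v i`!%:R * t ^+ i.
Proof.
rewrite -/g; have [C C0 hC] := iter_err i.
set X := v _ * _; have X0 : 0 < X.
  apply: mulr_gt0; first exact: (abs_fact_gt0 hv vM v_eq0 pp vp).
  by rewrite exprn_gt0 ?(lt_le_trans ltr01).
have [n hn] : exists n, C * d ^+ n <= X.
  have [n hn] := expr_le_small d0 d1 (divr_gt0 X0 (ltr_pwDr ltr01 C0)).
  exists n; move: hn; rewrite ler_pdivlMr ?ltr_pwDr // mulrC; apply: le_trans.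
  by apply: ler_wpM2r; rewrite ?exprn_ge0 // lerDl.
set y := dconn D g i; have wn : N (w n) <= 1.
  rewrite -(subrK 1 (w n)); apply: (usnD_le hN); last exact: (usn1 hN).
  exact: le_trans (w1 n) (ltW d1).
have : N y <= Num.max X (N y * d).
  have {1}-> : y = iter i D (w n) - (iter i D (w n) - y * w n) - y * (w n - 1) by ring.
  apply: le_trans (usnD hN _ _) _; rewrite ge_max !le_max; apply/andP; split; apply/orP; [left|right].
    apply: (usnB_le hN); last exact: le_trans (hC n) hn.
    apply: le_trans (gauss_iter_derT _ _) _; rewrite /X; apply: ler_wpM2l; first exact: (usn_ge0 hv).
    by apply: ler_piMr => //; apply: exprn_ge0.
  by apply: le_trans (usnN hN _) _; apply: (usnM_le hN).
(* The alternative [N y <= N y * d] with [d < 1] forces [N y = 0]. *)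
rewrite le_max => /orP[//|h]; have y0 := usn_ge0 hN y.
suff -> : N y = 0 by apply: ltW.
apply/eqP; rewrite eq_le y0 andbT leNgt; apply/negP => yp.
by move: h; rewrite ler_pMr // leNgt d1.
Qed.

End Comparison.
End Blocks.

(** * The sum of the blocks *)

Section TopCoef.
Variable F : comNzRingType.
Implicit Types P Q : {poly F}.

Lemma coefM_top P Q m n : (size P <= m.+1)%N -> (size Q <= n.+1)%N ->
  (P * Q)`_(m + n) = P`_m * Q`_n.
Proof.
move=> hP hQ; have hm : (m < (m + n).+1)%N by rewrite ltnS leq_addr.
rewrite coefM (bigD1 (Ordinal hm)) //= addKn big1 ?addr0 // => j.
rewrite -val_eqE /= => hj; case: (ltnP m j) => h.
  by rewrite [P`_j]nth_default ?mul0r //; apply: leq_trans hP h.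
rewrite [Q`__]nth_default ?mulr0 //; apply: leq_trans hQ _.
by have : (j < m)%N; [rewrite ltn_neqAle hj|have := ltn_ord j; lia].
Qed.

Lemma sizeM_le P Q m n : (size P <= m.+1)%N -> (size Q <= n.+1)%N ->
  (size (P * Q)%R <= (m + n).+1)%N.
Proof. by move=> hP hQ; apply: leq_trans (size_polyMleq _ _) _; lia. Qed.

Lemma sizeX_le P m k : (size P <= m.+1)%N -> (size (P ^+ k) <= (m * k).+1)%N.
Proof.
move=> hP; elim: k => [|k IH]; first by rewrite expr0 muln0 size_poly1.
by rewrite exprS mulnS; apply: sizeM_le.
Qed.

Lemma coefX_top P m k : (size P <= m.+1)%N -> (P ^+ k)`_(m * k) = P`_m ^+ k.
Proof.
move=> hP; elim: k => [|k IH]; first by rewrite !expr0 muln0 coef1.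
by rewrite !exprS mulnS coefM_top ?IH // sizeX_le.
Qed.

Lemma size_derT_le P m : (size P <= m.+1)%N -> (size (derT P) <= m.+2)%N.
Proof.
move=> hP; apply/leq_sizeP => j hj; rewrite coef_derT nth_default ?mulr0 ?oppr0 //.
by apply: leq_trans hP _; lia.
Qed.

(** Multiplication by [g] raises the degree bound by [b.+2 >= 2], [derT] only by [1], so the
    derivative never reaches the top coefficient. This is where [beta > 0] is needed. *)
Lemma dconn_top (g : {poly F}) b k : (size g <= b.+3)%N ->
  (size (dconn (@derT F) g k) <= (b.+2 * k).+1)%N /\
  (dconn (@derT F) g k)`_(b.+2 * k) = g`_b.+2 ^+ k.
Proof.
move=> hg; elim: k => [|k [IH1 IH2]].
  by rewrite dconn0 muln0 size_poly1 expr0 coef1.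
rewrite dconnS mulnS; have hD := size_derT_le IH1; split.
  apply: leq_trans (size_polyD _ _) _; rewrite geq_max; apply/andP; split.
    by apply: leq_trans hD _; lia.
  by rewrite addnC; apply: sizeM_le.
rewrite coefD nth_default; last by apply: leq_trans hD _; lia.
by rewrite add0r addnC coefM_top // IH2 exprSr.
Qed.

End TopCoef.

Section Irr.
Variables (R : archiRealFieldType) (F : fieldType) (v : F -> R) (p : nat).
Hypotheses (hv : ultra_seminorm v) (vM : {morph v : x y / x * y}).
Hypotheses (v_eq0 : forall x, v x = 0 -> x = 0).
Hypotheses (pp : prime p) (vp : v p%:R = p%:R^-1).
Variables (pi : nat -> F) (w : R).
Hypotheses (pi_le1 : forall j, v (pi j) <= 1) (pi0 : v (pi 0%N) = w).

(** The derivative of [\sum_(l <= m) pi_(m-l) Y^(p^l) / p^l]. *)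
Definition LTq m : {poly F} := expo_q p (fun l => pi (m - l)%N) m.+1.

Hypothesis LTq_int : forall m n, v (ode (LTq m) n) <= 1.

Local Notation D := (@derT F).

Definition block m (A : {poly F}) : {poly F} := (LTq m \Po A) * D A.

Let p0 : (0 < p)%N := prime_gt0 pp.

Lemma LTq_coef m i : v (LTq m)`_i <= 1.
Proof. by apply: abs_expo_q_le. Qed.

Section Bounds.
Variable t : R.
Hypothesis t1 : 1 <= t.
Let t0 : 0 <= t := le_trans ler01 t1.
Local Notation N := (gauss v t).
Let hN : ultra_seminorm N := gauss_seminorm hv t0.

(** The factor [|k!|] matters: it equals [|'C(k, j)| |j!| |(k-j)!|], which absorbs Leibniz's rule
    exactly. *)
Lemma gauss_dconnD g h (r : R) : 0 <= r ->
  (forall k, N (dconn D g k) <= v k`!%:R * r ^+ k) ->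
  (forall k, N (dconn D h k) <= v k`!%:R * r ^+ k) ->
  forall k, N (dconn D (g + h) k) <= v k`!%:R * r ^+ k.
Proof.
move=> r0 hg hh k; rewrite (dconnD (@derTD F) (@derTM F)).
apply: (usn_sum_le hN) => [|j _]; first by rewrite mulr_ge0 ?exprn_ge0 ?(usn_ge0 hv).
have hj : (j <= k)%N by rewrite -ltnS.
rewrite -scaler_nat; apply: le_trans (gaussZ hv t1 _ _) _.
have -> : v k`!%:R * r ^+ k = v 'C(k, j)%:R * ((v j`!%:R * r ^+ j) * (v (k - j)`!%:R * r ^+ (k - j))).
  have -> : r ^+ k = r ^+ j * r ^+ (k - j) by rewrite -exprD subnKC.
  by rewrite -{1}(bin_fact hj) !natrM !vM; ring.
by apply: ler_wpM2l; [exact: (usn_ge0 hv)|exact: (usnM_le hN)].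
Qed.

Lemma gauss_dconn_sum (I : Type) (l : seq I) (g : I -> {poly F}) (r : R) : 0 <= r ->
  (forall i k, N (dconn D (g i) k) <= v k`!%:R * r ^+ k) ->
  forall k, N (dconn D (\sum_(i <- l) g i) k) <= v k`!%:R * r ^+ k.
Proof.
move=> r0 hg; elim: l => [|i l IH] k; last by rewrite big_cons; apply: gauss_dconnD.
rewrite big_nil; case: k => [|k].
  by rewrite dconn0 expr0 mulr1 (abs1 vM v_eq0) (usn1 hN).
have -> : dconn D 0 k.+1 = 0.
  by elim: k => [|k IH]; rewrite dconnS mulr0 addr0 ?IH /derT ?deriv0 -?polyC1 ?derivC mulr0 oppr0.
by rewrite (usn0 hN) mulr_ge0 ?exprn_ge0 ?(usn_ge0 hv).
Qed.

Lemma gauss_dconn_LTblock m A n b k : N A <= t ^+ n -> (n * p ^ m <= b)%N ->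
  N (dconn D (block m A) k) <= v k`!%:R * (t ^+ b.+1) ^+ k.
Proof.
move=> hA hb; have tp : 0 < t := lt_le_trans ltr01 t1.
have e : (p ^ m).-1.+1 = (p ^ m)%N by rewrite prednK ?expn_gt0 ?p0.
(* Here [M = p^m - 1], [a = t^n] and [r = t^-(b+1)]; the condition [r t a^(M+1) <= 1] becomes
   [t^(n p^m) <= t^b]. *)
have := @gauss_dconn_block R F v p hv vM v_eq0 pp vp t t1 (LTq m) (p ^ m).-1 (t ^+ n)
  (expo_q_size pp _ m) (LTq_int m) (exprn_ege1 _ t1) A (t ^- b.+1) k hA.
rewrite invr_gt0 exprn_gt0 // => /(_ isT); rewrite exprVn invrK; apply.
rewrite e -exprM exprS invfM.
have -> : t^-1 * t ^- b * t * t ^+ (n * p ^ m) = (t^-1 * t) * (t ^+ (n * p ^ m) / t ^+ b) by ring.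
rewrite mulVf ?gt_eqF // mul1r ler_pdivrMr ?exprn_gt0 //.
by rewrite mul1r ler_weXn2l.
Qed.

Lemma gauss_dconn_LTblockB m A B n (d : R) k :
  N A <= t ^+ n -> N B <= t ^+ n -> N (A - B) * (t ^+ n) ^+ (p ^ m).-1 <= d -> d < 1 ->
  N (dconn D (block m A - block m B) k) <= v k`!%:R * t ^+ k.
Proof.
move=> hA hB hd d1.
exact: (gauss_dconn_comparison hv vM v_eq0 pp vp t1 (expo_q_size pp _ m) (LTq_int m)
  (LTq_coef m) (exprn_ege1 _ t1) hA hB (lexx _) hd d1).
Qed.

End Bounds.

Lemma LTblock_size m (A : {poly F}) n : (size A <= n.+1)%N -> (size (block m A) <= (n * p ^ m).+2)%N.
Proof.
move=> hA; rewrite /block.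
have h1 : (size (LTq m \Po A) <= (n * (p ^ m).-1).+1)%N.
  rewrite /LTq raddf_sum /=; apply: leq_trans (size_sum _ _ _) _; apply/bigmax_leqP => l _.
  rewrite comp_polyZ comp_Xn_poly; apply: leq_trans (size_scale_leq _ _) _.
  apply: leq_trans (sizeX_le _ hA) _; rewrite ltnS leq_mul2l; apply/orP; right.
  have : (p ^ l <= p ^ m)%N by rewrite leq_pexp2l // -ltnS.
  lia.
apply: leq_trans (sizeM_le h1 (size_derT_le hA)) _.
have : (0 < p ^ m)%N by rewrite expn_gt0 p0.
nia.
Qed.

(** The term [l = m] alone reaches the top degree, with coefficient [pi_0] times a unit; [derT]
    contributes the factor [n], a unit because [n] is prime to [p]. *)
Lemma LTblock_top m (A : {poly F}) n : (size A <= n.+1)%N -> (0 < n)%N -> coprime n p ->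
  v A`_n = 1 -> v (block m A)`_(n * p ^ m).+1 = w.
Proof.
move=> hA n0 cop hlc; rewrite /block.
have -> : ((n * p ^ m).+1 = n * (p ^ m).-1 + n.+1)%N.
  have : (0 < p ^ m)%N by rewrite expn_gt0 p0.
  nia.
have hX l : (l <= m)%N -> (size (A ^+ (p ^ l).-1) <= (n * (p ^ l).-1).+1)%N.
  by move=> _; apply: sizeX_le.
have lt_pow l : (l < m)%N -> (p ^ l < p ^ m)%N by move=> h; rewrite ltn_exp2l ?prime_gt1.
have pl l : (0 < p ^ l)%N by rewrite expn_gt0 p0.
have eq : LTq m \Po A = \sum_(l < m.+1) pi (m - l)%N *: A ^+ (p ^ l).-1.
  by rewrite /LTq raddf_sum; apply: eq_bigr => l _; rewrite /= comp_polyZ comp_Xn_poly.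
have h1 : (size (LTq m \Po A) <= (n * (p ^ m).-1).+1)%N.
  rewrite eq; apply: leq_trans (size_sum _ _ _) _; apply/bigmax_leqP => l _.
  apply: leq_trans (size_scale_leq _ _) _; have := ltn_ord l; rewrite ltnS => hl.
  apply: leq_trans (hX _ hl) _; rewrite ltnS leq_mul2l; apply/orP; right.
  have : (p ^ l <= p ^ m)%N by rewrite leq_pexp2l.
  lia.
rewrite (coefM_top h1 (size_derT_le hA)) coef_derT /= vM (absN hv) vM hlc mulr1.
rewrite (abs_coprime hv vM v_eq0 pp vp cop) mulr1 eq big_ord_recr /= coefD coef_sum big1.
  by rewrite add0r subnn coefZ coefX_top // vM (absX vM v_eq0) hlc expr1n mulr1.
move=> l _; rewrite coefZ nth_default ?mulr0 //.
apply: leq_trans (hX l (ltnW (ltn_ord l))) _.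
rewrite ltn_mul2l n0 /=; have := lt_pow l (ltn_ord l); have := pl l; lia.
Qed.

Section Sum.
Variables (s : nat) (n : 'I_s.+1 -> nat).
Hypothesis n_cop : forall i, coprime (n i) p \/ n i = 0%N.

Let beta := \max_(i < s.+1) (n i * p ^ (s - i))%N.

(** For [i < j] the equality gives [n j = n i * p ^ (j - i)], which is divisible by [p]. *)
Lemma max_index_uniq i j : (0 < n i)%N -> (0 < n j)%N ->
  (n i * p ^ (s - i) = n j * p ^ (s - j))%N -> i = j.
Proof.
wlog : i j / (i <= j)%N.
  move=> H hi hj e; case/orP: (leq_total i j) => h; first exact: H.
  by apply/esym; apply: H.
move=> hij hi hj e; apply/val_inj/eqP; rewrite /= eqn_leq hij leqNgt; apply/negP => lt_ij.
have hs : (s - i = (j - i) + (s - j))%N by have := ltn_ord j; lia.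
move: e; rewrite hs expnD mulnA => /eqP; rewrite eqn_pmul2r ?expn_gt0 ?p0 // => /eqP e.
have [cop|] := n_cop j; last by lia.
have : (p %| n j)%N by rewrite -e dvdn_mull // dvdn_exp // subn_gt0.
by move=> dv; move: cop; rewrite coprime_sym prime_coprime // dv.
Qed.

Lemma sum_LTblock_top (g : 'I_s.+1 -> {poly F}) : (0 < beta)%N ->
  (forall i, size (g i) <= (n i).+1)%N -> (forall i, (0 < n i)%N -> v (g i)`_(n i) = 1) ->
  (forall i, n i = 0%N -> g i = 0) ->
  (size (\sum_(i < s.+1) block (s - i) (g i))%R <= beta.+2)%N /\
  v (\sum_(i < s.+1) block (s - i) (g i))`_beta.+1 = w.
Proof.
move=> b0 sg lg g0; have le_b i : (n i * p ^ (s - i) <= beta)%N.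
  exact: (leq_bigmax (F := fun i : 'I_s.+1 => (n i * p ^ (s - i))%N)).
split.
  apply: leq_trans (size_sum _ _ _) _; apply/bigmax_leqP => i _.
  by apply: leq_trans (LTblock_size _ (sg i)) _; rewrite !ltnS.
have c0 : (0 < #|'I_s.+1|)%N by rewrite card_ord.
have [i0 hi0] := bigop.eq_bigmax (fun i : 'I_s.+1 => (n i * p ^ (s - i))%N) c0.
rewrite -/beta in hi0.
have n0 : (0 < n i0)%N by move: b0; rewrite hi0 muln_gt0 => /andP[].
rewrite coef_sum (bigD1 i0) //= big1 => [|i hi].
  rewrite addr0 hi0; apply: LTblock_top => //; last exact: lg.
  by have [//|e] := n_cop i0; move: n0; rewrite e.
have [ni|ni] := posnP (n i).
  by rewrite (g0 _ ni) /block /derT deriv0 mulr0 oppr0 mulr0 coef0.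
rewrite nth_default //; apply: leq_trans (LTblock_size _ (sg i)) _.
rewrite !ltnS ltn_neqAle le_b andbT; apply/negP => /eqP e.
by move/eqP: hi; apply; apply: max_index_uniq => //; rewrite e.
Qed.

Variables (t : R) (f g : 'I_s.+1 -> {poly F}).
Hypothesis t1 : 1 <= t.
Local Notation N := (gauss v t).

Lemma sum_LTblock_upper : (forall i, N (f i) <= t ^+ n i) ->
  forall k, N (dconn D (\sum_(i < s.+1) block (s - i) (f i)) k) <= v k`!%:R * (t ^+ beta.+1) ^+ k.
Proof.
move=> hf; apply: gauss_dconn_sum => //; first by rewrite exprn_ge0 // (le_trans ler01).
move=> i k; apply: (gauss_dconn_LTblock t1) => //.
exact: (leq_bigmax (F := fun i : 'I_s.+1 => (n i * p ^ (s - i))%N)).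
Qed.

(** The sum for [g] is the sum for [f] plus differences of nearby blocks, whose [l]-th iterates have
    norm at most [|l!| t^l]. Leibniz's rule transfers the leading coefficient for [g] to [f]. The
    bound [B] is arbitrary, so that an assumed growth rate can be refuted. *)
Lemma sum_LTblock_lower : (0 < beta)%N ->
  (forall i, N (f i) <= t ^+ n i) -> (forall i, N (g i) <= t ^+ n i) ->
  (forall i, N (g i - f i) * (t ^+ n i) ^+ (p ^ (s - i)).-1 < 1) ->
  (forall i, size (g i) <= (n i).+1)%N -> (forall i, (0 < n i)%N -> v (g i)`_(n i) = 1) ->
  (forall i, n i = 0%N -> g i = 0) ->
  forall k (B : R), 0 <= B ->
  (forall j, (j <= k)%N ->
     N (dconn D (\sum_(i < s.+1) block (s - i) (f i)) j) * (v (k - j)`!%:R * t ^+ (k - j)) <= B) ->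
  (w * t ^+ beta.+1) ^+ k <= B.
Proof.
move=> b0 hf hg hfg sg lg g0 k B B0 hB; have t0 := le_trans ler01 t1.
have hN := gauss_seminorm hv t0.
set Lf := \sum_i _ in hB *; set Lg := \sum_(i < s.+1) block (s - i) (g i).
have [sL wL] := sum_LTblock_top b0 sg lg g0.
have [_ top] : (size (dconn D Lg k) <= (beta.+1 * k).+1)%N /\
    (dconn D Lg k)`_(beta.+1 * k) = Lg`_beta.+1 ^+ k.
  by case: (beta) b0 sL => // b _; apply: dconn_top.
apply: (@le_trans _ _ (N (dconn D Lg k))).
  apply: le_trans (gauss_coef hv t0 _ (beta.+1 * k)%N).
  by rewrite top (absX vM v_eq0) wL exprMn exprM.
have -> : Lg = Lf + \sum_(i < s.+1) (block (s - i) (g i) - block (s - i) (f i)).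
  by rewrite sumrB addrC subrK.
rewrite (dconnD (@derTD F) (@derTM F)); apply: (usn_sum_le hN) => // j _.
apply: (usnMn_le hN); apply: le_trans (usnM hN _ _) _.
apply: le_trans (hB j _); last by rewrite -ltnS.
apply: ler_wpM2l; first exact: (usn_ge0 hN).
apply: (gauss_dconn_sum t1) => // i l.
exact: (gauss_dconn_LTblockB t1 _ (hg i) (hf i) (lexx _) (hfg i)).
Qed.

End Sum.
End Irr.

(** * Laurent polynomials *)

Section FpsExp.
Variables (F : fieldType) (nz : forall n, n.+1%:R != 0 :> F).
Variables (h : {poly F}) (h0 : h`_0 = 0).

Let E n : {poly F} := \sum_(i < n.+1) i`!%:R^-1 *: h ^+ i.

Let fps_expE n N : (n <= N)%N -> fps_exp h n = (E N)`_n.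
Proof.
move=> hn; have hX i : (n < i)%N -> (h ^+ i)`_n = 0.
  move=> hi; have -> : h = 'X * drop_poly 1 h.
    apply/polyP => -[|k]; rewrite coefXM ?h0 //= coef_drop_poly addn1 //.
  by rewrite exprMn coefXnM hi.
rewrite /fps_exp /E coef_sum.
rewrite -(big_mkord xpredT (fun i => i`!%:R^-1 * (h ^+ i)`_n)).
rewrite -(big_mkord xpredT (fun i => (i`!%:R^-1 *: h ^+ i)`_n)).
rewrite [RHS](big_cat_nat (n := n.+1)) //=.
rewrite [X in _ = _ + X]big1_seq ?addr0; first by apply: eq_bigr => i _; rewrite coefZ.
by move=> i /andP[_]; rewrite mem_index_iota => /andP[hi _]; rewrite coefZ hX ?mulr0.
Qed.

Let E_deriv n : (E n.+1)^`() = h^`() * E n.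
Proof.
rewrite /E big_ord_recl derivD expr0 derivZ derivC scaler0 add0r raddf_sum mulr_sumr.
apply: eq_bigr => i _; rewrite /= derivZ deriv_exp /= /bump add1n -scaler_nat scalerA.
rewrite factS natrM invfM mulrAC mulVf // mul1r scalerAr //.
Qed.

Lemma fps_exp0 : fps_exp h 0 = 1.
Proof. by rewrite /fps_exp big_ord1 expr0 fact0 invr1 mul1r coef1. Qed.

Lemma fps_expS n :
  n.+1%:R * fps_exp h n.+1 = \sum_(i < n.+1) (h^`())`_i * fps_exp h (n - i).
Proof.
rewrite (fps_expE (leqnn _)) mulr_natl -coef_deriv E_deriv coefM.
by apply: eq_bigr => i _; rewrite -(fps_expE (leq_subr _ _)).
Qed.

(** As [exp h] has constant term [1], the relation determines the quotient degree by degree, and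
    [T d/dT] is [- Z d/dZ]. In particular the connection is a polynomial in [Z]. *)
Lemma dlog_fps_exp g : is_dlog (fps_exp h) g ->
  g = laurent_of_fps (fun n => (- ('X * h^`()))`_n).
Proof.
move=> [w hw ->]; congr laurent_of_fps; apply/funext => n.
have hW m : \sum_(i < m.+1) (- ('X * h^`()))`_i * fps_exp h (m - i) = - (m%:R * fps_exp h m).
  rewrite big_ord_recl coefN coefXM /= oppr0 mul0r add0r.
  case: m => [|m]; first by rewrite big_ord0 mul0r oppr0.
  rewrite fps_expS -sumrN; apply: eq_bigr => i _.
  by rewrite /= /bump add1n coefN coefXM /= subSS mulNr.
elim/ltn_ind: n => n IH.
have := congr1 (fun f => f n) hw; rewrite /fps_mul /fps_theta -hW.
rewrite big_ord_recr [RHS]big_ord_recr /= subnn fps_exp0 !mulr1.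
rewrite (eq_bigr (fun i : 'I_n => (- ('X * h^`()))`_i * fps_exp h (n - i))).
  by move/addrI.
by move=> i _; rewrite IH.
Qed.

End FpsExp.

Section Vcvg.
Variables (R : realType) (F : fieldType) (v : F -> R).
Hypothesis hv : ultra_seminorm v.
Hypothesis v_eq0 : forall x, v x = 0 -> x = 0.

Lemma vcvgP (u : nat -> F) l : vcvg v u l <->
  forall e : R, 0 < e -> exists N, forall n, (N <= n)%N -> v (u n - l) < e.
Proof.
rewrite /vcvg; split=> [/cvgrPdist_lt h e e0|h].
  have [N _ hN] := h e e0; exists N => n hn; have := hN n hn.
  by rewrite /= sub0r normrN ger0_norm // (usn_ge0 hv).
apply/cvgrPdist_lt => e e0; have [N hN] := h e e0.
by exists N => // n hn; rewrite /= sub0r normrN ger0_norm ?(usn_ge0 hv) // hN.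
Qed.

Lemma vcvg_eventually_cst (u : nat -> F) (c : F) n0 :
  (forall n, (n0 <= n)%N -> u n = c) -> forall l, vcvg v u l <-> l = c.
Proof.
move=> hu l; rewrite vcvgP; split=> [h|-> e e0]; last first.
  by exists n0 => n hn; rewrite hu // subrr (usn0 hv).
apply/esym/eqP; rewrite -subr_eq0; apply/eqP/v_eq0/eqP.
rewrite eq_le (usn_ge0 hv) andbT leNgt; apply/negP => /h[N hN].
by have := hN _ (leq_maxr n0 N); rewrite hu ?leq_maxl // ltxx.
Qed.

End Vcvg.

Section LaurentPoly.
Variables (R : realType) (F : fieldType) (v : F -> R).
Hypothesis hv : ultra_seminorm v.
Hypothesis v_eq0 : forall x, v x = 0 -> x = 0.

Definition laurent_of_poly (q : {poly F}) : laurent F := laurent_of_fps (nth 0 q).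

Lemma laurent_of_polyN (q : {poly F}) (k : nat) : laurent_of_poly q (- k%:Z) = q`_k.
Proof. by rewrite /laurent_of_poly /laurent_of_fps oppr_le0 le0z_nat abszN. Qed.

Lemma laurent_of_polyP (q : {poly F}) (k : nat) : laurent_of_poly q k.+1%:Z = 0.
Proof. by []. Qed.

Variant int_spec : int -> Type :=
  | IntNpos (k : nat) : int_spec (- k%:Z)
  | IntPos (k : nat) : int_spec k.+1%:Z.

Lemma int_specP n : int_spec n.
Proof.
case: n => [[|k]|k]; last by rewrite NegzE; apply: IntNpos.
  exact: (IntNpos 0).
exact: IntPos.
Qed.

Lemma lone_poly : @lone F = laurent_of_poly 1.
Proof.
apply/funext => n; case: (int_specP n) => k //.
by rewrite laurent_of_polyN coef1 /lone oppr_eq0.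
Qed.

Lemma ladd_poly q r : ladd (laurent_of_poly q) (laurent_of_poly r) = laurent_of_poly (q + r).
Proof.
apply/funext => n; rewrite /ladd; case: (int_specP n) => k.
  by rewrite !laurent_of_polyN coefD.
by rewrite !laurent_of_polyP addr0.
Qed.

Lemma ldivT_poly q : ldivT (laurent_of_poly q) = laurent_of_poly ('X * q).
Proof.
apply/funext => n; rewrite /ldivT; case: (int_specP n) => [[|k]|k].
- by rewrite laurent_of_polyN oppr0 add0r coefXM laurent_of_polyP.
- rewrite laurent_of_polyN coefXM /=.
  by rewrite (_ : - k.+1%:Z + 1 = - k%:Z) ?laurent_of_polyN // -addn1 PoszD opprD addrNK.
- by rewrite (_ : k.+1%:Z + 1 = k.+2%:Z) // -[k.+2]addn1 PoszD.
Qed.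

Lemma lderiv_poly q : lderiv (laurent_of_poly q) = laurent_of_poly (derT q).
Proof.
apply/funext => n; rewrite /lderiv; case: (int_specP n) => [[|k]|k].
- by rewrite laurent_of_polyN oppr0 add0r laurent_of_polyP coef_derT mul0r mulr0 oppr0.
- rewrite laurent_of_polyN coef_derT /=.
  rewrite (_ : - k.+1%:Z + 1 = - k%:Z) ?laurent_of_polyN; last by rewrite -addn1 PoszD opprD addrNK.
  by rewrite rmorphN mulNr.
- by rewrite (_ : k.+1%:Z + 1 = k.+2%:Z) ?laurent_of_polyP ?mulr0 // -[k.+2]addn1 PoszD.
Qed.

Lemma lmul_poly q r :
  lmul v (laurent_of_poly q) (laurent_of_poly r) = laurent_of_poly (q * r).
Proof.
apply/funext => n; rewrite /lmul.
pose u N := \sum_(i < N.*2.+1)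
  laurent_of_poly q (i%:Z - N%:Z) * laurent_of_poly r (n - (i%:Z - N%:Z)).
(* The partial sums are constant once the window contains every pair of exponents contributing to
   degree [n], so the chosen limit is that constant. *)
have hu N : (`|n| <= N)%N -> u N = laurent_of_poly (q * r) n.
  move=> hN; rewrite /u -(big_mkord xpredT (fun i => laurent_of_poly q (i%:Z - N%:Z) *
    laurent_of_poly r (n - (i%:Z - N%:Z)))) (big_cat_nat (n := N.+1)) //=; last first.
    by rewrite ltnS -addnn leq_addr.
  rewrite [X in _ + X]big1_seq ?addr0; last first.
    move=> i /andP[_]; rewrite mem_index_iota => /andP[hi _].
    have -> : i%:Z - N%:Z = (i - N).-1.+1%:Z.
      by rewrite prednK ?subn_gt0 // -subzn // ltnW.
    by rewrite laurent_of_polyP mul0r.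
  rewrite big_mkord (reindex_inj rev_ord_inj) /=.
  rewrite (eq_bigr (fun i : 'I_N.+1 => q`_i * laurent_of_poly r (n + i%:Z))); last first.
    move=> i _; have -> : (N.+1 - i.+1)%:Z - N%:Z = - i%:Z.
      by rewrite subSS -subzn -1?ltnS // addrAC subrr add0r.
    by rewrite laurent_of_polyN opprK.
  move: hN; case: (int_specP n) => k hk; last by rewrite big1 // => i _; rewrite -PoszD addSn laurent_of_polyP mulr0.
  rewrite abszN /= in hk; rewrite laurent_of_polyN coefM.
  rewrite -(big_mkord xpredT (fun i => q`_i * laurent_of_poly r (- k%:Z + i%:Z))).
  rewrite (big_cat_nat (n := k.+1)) //= [X in _ + X]big1_seq ?addr0; last first.
    move=> i /andP[_]; rewrite mem_index_iota => /andP[hi _].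
    have -> : - k%:Z + i%:Z = (i - k).-1.+1%:Z.
      by rewrite prednK ?subn_gt0 // -subzn 1?addrC // ltnW.
    by rewrite laurent_of_polyP mulr0.
  rewrite big_mkord; apply: eq_bigr => i _; congr (_ * _).
  have hi : (i <= k)%N by rewrite -ltnS.
  have -> : - k%:Z + i%:Z = - (k - i)%N%:Z by rewrite -subzn // opprB addrC.
  by rewrite laurent_of_polyN.
have hl := vcvg_eventually_cst hv v_eq0 hu.
by case: xgetP => [l -> /hl //|/(_ (laurent_of_poly (q * r) n))]; case; apply/hl.
Qed.

Lemma lconn_poly g i : lconn v (laurent_of_poly g) i = laurent_of_poly (dconn (@derT F) ('X * g) i).
Proof.
elim: i => [|i IH]; first by rewrite dconn0 -lone_poly.
by rewrite /= IH lderiv_poly ldivT_poly lmul_poly ladd_poly.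
Qed.

Lemma gauss_norm_poly (q : {poly F}) (rho : R) : 0 < rho ->
  gauss_norm v (laurent_of_poly q) rho = (gauss v rho^-1 q)%:E.
Proof.
move=> r0; have t0 : 0 <= rho^-1 by rewrite invr_ge0 ltW.
have termE k : v (laurent_of_poly q (- k%:Z)) * rho ^ (- k%:Z) = v q`_k * rho^-1 ^+ k.
  by rewrite laurent_of_polyN exprVn -exprnN.
apply/eqP; rewrite eq_le; apply/andP; split.
  apply: ub_ereal_sup => _ [n _ <-]; rewrite lee_fin; case: (int_specP n) => k.
    by rewrite termE gauss_coef.
  by rewrite laurent_of_polyP (usn0 hv) mul0r gauss_ge0.
set X := gauss_norm _ _ _; have hX k : ((v q`_k * rho^-1 ^+ k)%:E <= X)%E.
  by apply: ereal_sup_ubound; exists (- k%:Z) => //; rewrite termE.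
move: hX; case: X => [x|_|hX]; last by have := hX 0%N.
  move=> hX; rewrite lee_fin; apply: gauss_le => [|i]; last by rewrite -lee_fin.
  have := hX 0%N; rewrite lee_fin; apply: le_trans.
  by rewrite mulr_ge0 ?exprn_ge0 ?(usn_ge0 hv).
by rewrite leey.
Qed.

End LaurentPoly.

(** * Lubin-Tate generators *)

Lemma ultrametric_abs_seminorm (R : realType) (F : fieldType) (v : F -> R) :
  ultrametric_abs v -> ultra_seminorm v.
Proof.
move=> hv; have v0 : v 0 = 0 by apply/(uabs_eq0 hv).
have v1 : v 1 = 1.
  have v1n : v 1 != 0 by apply/eqP => /(uabs_eq0 hv)/eqP; rewrite oner_eq0.
  by apply: (mulfI v1n); rewrite -(uabsM hv) !mulr1.
have vN1 : v (-1) = 1.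
  apply/eqP; rewrite -(@eqrXn2 _ 2) ?(uabs_ge0 hv) // expr1n expr2 -(uabsM hv).
  by rewrite mulrNN mulr1 v1.
split=> [||||x y|x y]; rewrite ?v0 ?v1 ?(uabsM hv) //; first exact: (uabs_ge0 hv).
  by move=> x; rewrite -mulN1r (uabsM hv) vN1 mul1r.
exact: (uabsD hv).
Qed.

Section LubinTate.
Variables (R : realType) (p : nat) (K : fieldType) (absK : K -> R).
Variables (Omega : fieldType) (iota : {rmorphism K -> Omega}) (abs : Omega -> R).
Variables (P : nat -> K) (pi : nat -> Omega).
Hypotheses (pp : prime p) (hK : ultrametric_abs absK) (absKp : absK p%:R = p%:R^-1).
Hypotheses (hO : ultrametric_abs abs) (abs_iota : forall x, abs (iota x) = absK x).
Hypotheses (hP : lubin_tate absK p P) (hpi : tate_generator iota abs P pi).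

Let sK := ultrametric_abs_seminorm hK.
Let sO := ultrametric_abs_seminorm hO.
Let absM : {morph abs : x y / x * y} := uabsM hO.
Let abs_eq0 x : abs x = 0 -> x = 0 := (uabs_eq0 hO x).1.
Let absp : abs p%:R = p%:R^-1.
Proof. by rewrite -(rmorph_nat iota) abs_iota. Qed.

Let pK0 : p%:R != 0 :> K.
Proof. by case: (p) (prime_gt0 pp) => // n _; apply: (natF_neq0 sK (uabsM hK) _ pp absKp) => x /(uabs_eq0 hK). Qed.

Let lt_coef : exists y : nat -> K, forall i,
  Zp_in absK (y i) /\ P i = (i == p)%:R + p%:R * y i.
Proof.
suff [y hy] : {y : nat -> K & forall i, Zp_in absK (y i) /\ P i = (i == p)%:R + p%:R * y i} by exists y.
apply: (@choice _ _ (fun i y => Zp_in absK y /\ P i = (i == p)%:R + p%:R * y)) => i.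
by have [y hy e] := lt_modp hP i; exists y; split=> //; rewrite -e addrC subrK.
Qed.

Lemma Zp_in_le1 y : Zp_in absK y -> absK y <= 1.
Proof.
move=> /(_ 1 ltr01)[z hz]; rewrite -(subrK z%:~R y); apply: (usnD_le sK); first exact: ltW.
by apply: (abs_int sK).
Qed.

Let psum n x : Omega := \sum_(i < n) iota (P i) * x ^+ i.

Let psumE (y : nat -> K) n x : (forall i, P i = (i == p)%:R + p%:R * y i) ->
  (p < n)%N -> psum n x = x ^+ p + p%:R * \sum_(i < n) iota (y i) * x ^+ i.
Proof.
move=> hy hn; rewrite mulr_sumr /psum.
rewrite (eq_bigr (fun i : 'I_n => (i == p :> nat)%:R * x ^+ i + p%:R * (iota (y i) * x ^+ i))).
  rewrite big_split /= (bigD1 (Ordinal hn)) //= eqxx mul1r big1 ?addr0 // => i.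
  by rewrite -val_eqE /= => /negbTE ->; rewrite mul0r.
by move=> i _; rewrite hy rmorphD rmorphM !rmorph_nat; ring.
Qed.

(** Write [P = X^p + p (X + ...)]. At [x = pi_0] the second part has absolute value [|p| |x|], as
    [|x| < 1]; since [P(x) = 0], it must balance [|x|^p]. *)
Lemma abs_pi0 : abs (pi 0%N) ^+ p.-1 = p%:R^-1.
Proof.
have [y hy] := lt_coef; have p0 : 0 < p%:R^-1 :> R by rewrite invr_gt0 ltr0n prime_gt0.
have hyP i : P i = (i == p)%:R + p%:R * y i by have [] := hy i.
have y0 : y 0%N = 0.
  have := hyP 0%N; rewrite (lt_coef0 hP) eq_sym eqn0Ngt prime_gt0 // add0r => /esym/eqP.
  by rewrite mulf_eq0 (negbTE pK0) => /eqP.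
have y1 : y 1%N = 1.
  have := hyP 1%N; rewrite (lt_coef1 hP) eq_sym gtn_eqF ?prime_gt1 // add0r.
  by move=> e; apply: (mulfI pK0); rewrite -e mulr1.
set x := pi 0%N; have x0 : 0 < abs x by rewrite (abs_gt0 sO) // (tate_neq0 hpi).
have x1 : abs x < 1 := tate_lt1 hpi 0.
suff e : abs x ^+ p = p%:R^-1 * abs x.
  apply: (mulIf (lt0r_neq0 x0)); rewrite -e -exprSr prednK // prime_gt0 //.
have sumE n : (p < n)%N -> abs (p%:R * \sum_(i < n) iota (y i) * x ^+ i) = p%:R^-1 * abs x.
  move=> hn; rewrite absM absp; congr (_ * _).
  have n2 : (2 <= n)%N by apply: leq_trans hn; rewrite ltnW // ltnS prime_gt1.
  rewrite -(subnKC n2) big_split_ord /= !big_ord_recl big_ord0 /= y0 y1 rmorph0 rmorph1 mul0r add0r mul1r addr0.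
  rewrite /bump /= expr1; apply: (usnDr_lt sO).
  apply: (@le_lt_trans _ _ (abs x ^+ 2)); last by rewrite expr2 gtr_pMr.
  apply: (usn_sum_le sO) => [|i _]; first by rewrite exprn_ge0 // ltW.
  rewrite exprD mulrCA; apply: (usnMr_le1 sO); first exact: (usnX_le sO).
  apply: (usnMl_le1 sO); first by rewrite abs_iota; apply: Zp_in_le1; have [] := hy (2 + i)%N.
  by rewrite -(expr1n R i); apply: (usnX_le sO); apply: ltW.
have hlim : forall e : R, 0 < e -> exists n, (p < n)%N /\ abs (psum n x) < e.
  move=> e e0; have /(vcvgP sO)/(_ e e0)[N hN] := tate_root hpi.
  exists (maxn N p.+1); rewrite leq_maxr; split=> //.
  by have := hN _ (leq_maxl N p.+1); rewrite subr0.
(* If the two values differed, all late partial sums would have the larger one as absolute value and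
   could not tend to [0]. *)
case: (ltgtP (abs x ^+ p) (p%:R^-1 * abs x)) => // lt.
- have [n [hn]] := hlim _ (mulr_gt0 p0 x0).
  have h : abs (x ^+ p) < abs (p%:R * \sum_(i < n) iota (y i) * x ^+ i).
    by rewrite (sumE _ hn) (absX absM abs_eq0).
  by rewrite (psumE _ hyP hn) addrC (usnDr_lt sO h) (sumE _ hn) ltxx.
- have [n [hn]] := hlim _ (exprn_gt0 p x0).
  have h : abs (p%:R * \sum_(i < n) iota (y i) * x ^+ i) < abs (x ^+ p).
    by rewrite (sumE _ hn) (absX absM abs_eq0).
  by rewrite (psumE _ hyP hn) (usnDr_lt sO h) (absX absM abs_eq0) ltxx.
Qed.

(** Prepending the root [0] makes [P (Pi j) = Pi j.-1] hold for every [j], so iteration may run past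
    [pi_0]. The shift explains the index [m.+1] in the integrality of [LTq m]. *)
Let Pi j : Omega := if j is j'.+1 then pi j' else 0.

Let Pi_le1 j : abs (Pi j) <= 1.
Proof. by case: j => [|j]; rewrite /= ?(usn0 sO) // ltW // (tate_lt1 hpi). Qed.

Let Pi_series j : series_value iota abs P (Pi j) (Pi j.-1).
Proof.
case: j => [|[|j]]; [|exact: (tate_root hpi)|exact: (tate_succ hpi)].
apply/(vcvgP sO) => e e0; exists 1%N => -[//|n] _.
rewrite big_ord_recl /= (lt_coef0 hP) rmorph0 mul0r add0r big1 ?subr0 ?(usn0 sO) // => i _.
by rewrite exprS mul0r mulr0.
Qed.

Let Pi_approx : LT_approx abs p Pi.
Proof.
move=> e M e0; have [y hy] := lt_coef.
have hyP i : P i = (i == p)%:R + p%:R * y i by have [] := hy i.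
have [Nf hNf] : {Nf : nat -> nat & forall j n, (Nf j <= n)%N ->
    abs (psum n (Pi j) - Pi j.-1) < e}.
  apply: (@choice _ _ (fun j N => forall n, (N <= n)%N -> abs (psum n (Pi j) - Pi j.-1) < e)) => j.
  exact: ((vcvgP sO _ _).1 (Pi_series j) e e0).
have [z hz] : {z : nat -> int & forall i, absK (y i - (z i)%:~R) < e}.
  apply: (@choice _ _ (fun i (z : int) => absK (y i - z%:~R) < e)) => i.
  by have [/(_ e e0)] := hy i.
(* One truncation order serves all [j <= M], and [n > p] retains the term [X^p]. *)
pose n := maxn p.+1 (\max_(j < M.+1) Nf j).
have hn : (p < n)%N by rewrite leq_maxl.
(* The integers [z i] approximate the coefficients of [(P - X^p) / p]; the sign is that of
   ['X^p - T = p c]. *)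
pose c : {poly Omega} := \poly_(i < n) - (z i)%:~R.
have Zint (a : int) : Zloc p (a%:~R : Omega).
  by exists a, 1%N; rewrite coprime1n divr1.
have nzO := natF_neq0 sO absM abs_eq0 pp absp.
have CC : coefs_in (Zloc p) c.
  move=> i; rewrite coef_poly; case: ifP => _; last exact: (Zint 0).
  by rewrite -rmorphN; apply: Zint.
have hC := coefs_in_subring (Zloc_subring (F := Omega) pp nzO).
exists ('X^p - p%:R * c), c; split=> //.
- apply: (sbpB hC); first by apply: (sbpX hC); apply: coefs_inX (Zloc_subring pp nzO).
  by rewrite mulr_natl; apply: (sbpMn hC).
- by rewrite opprB addrC subrK.
move=> j hj; set x := Pi j.
rewrite -(subrK (psum n x) (_).[x]) -addrA; apply: (usnD_le sO); last first.
  apply/ltW/hNf; apply: leq_trans (leq_maxr _ _).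
  by apply: (leq_bigmax (F := fun j : 'I_M.+1 => Nf j) (Ordinal (hj : (j < M.+1)%N))).
rewrite (psumE _ hyP hn) hornerD hornerXn hornerN.
have -> : (p%:R * c).[x] = p%:R * c.[x] by rewrite -polyC_natr hornerCM.
rewrite horner_poly.
have -> : x ^+ p - p%:R * (\sum_(i < n) - (z i)%:~R * x ^+ i) -
    (x ^+ p + p%:R * (\sum_(i < n) iota (y i) * x ^+ i)) =
    p%:R * \sum_(i < n) (- iota (y i - (z i)%:~R)) * x ^+ i.
  rewrite [X in _ = _ * X](_ : _ = - \sum_(i < n) - (z i)%:~R * x ^+ i - \sum_(i < n) iota (y i) * x ^+ i).
    by ring.
  rewrite -!sumrN -big_split; apply: eq_bigr => i _ /=.
  by rewrite rmorphB rmorph_int; ring.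
apply: (usnMl_le1 sO); first exact: (usn_nat sO).
apply: (usn_sum_le sO) => [|i _]; first exact: ltW.
apply: (usnMr_le1 sO).
  by apply: le_trans (usnN sO _) _; rewrite abs_iota; apply/ltW.
by rewrite -(expr1n R i); apply: (usnX_le sO); apply: Pi_le1.
Qed.

Lemma LTq_integral m n : abs (ode (LTq p pi m) n) <= 1.
Proof.
have := @LT_exp_integral _ _ _ p sO absM abs_eq0 pp absp Pi m.+1 n erefl Pi_le1 Pi_approx.
rewrite (_ : expo_q _ _ _ = LTq p pi m) // /LTq /expo_q.
by apply: eq_bigr => l _; rewrite subSn // -ltnS.
Qed.

End LubinTate.

(** * From phantom components to the blocks *)

Section Phantom.
Variables (K Omega : fieldType) (iota : {rmorphism K -> Omega}).
Variables (p s : nat) (pi : nat -> Omega) (f : 'I_s.+1 -> {poly K}).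
Hypotheses (pp : prime p) (nzp : p%:R != 0 :> Omega).
Hypothesis f0 : forall i, (f i)`_0 = 0.

Let h : {poly Omega} := \sum_(j < s.+1)
  (pi (s - j)%N / p%:R ^+ j) *: map_poly iota (phantom_comp p f j).

Lemma pi_exp_log0 : h`_0 = 0.
Proof.
rewrite coef_sum big1 // => j _; rewrite coefZ coef_map coef_sum big1 => [|i _]; first by rewrite /= rmorph0 mulr0.
have -> : (p%:R ^+ i * f i ^+ (p ^ (j - i)))`_0 = 0; last by [].
rewrite -horner_coef0 hornerM [(f i ^+ _).[0]]horner_exp [(f i).[0]]horner_coef0 f0 expr0n.
by rewrite eqn0Ngt expn_gt0 prime_gt0 // mulr0.
Qed.

(** Exchange of summations with [j = i + l]: in [phi_j / p^j] the contribution of [f_i] is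
    [f_i^(p^l) / p^l], and [pi_(s-j) = pi_(s-i-l)]. *)
Lemma derT_pi_exp_log :
  derT h = \sum_(i < s.+1) block p pi (s - i) (map_poly iota (f i)).
Proof.
pose G (i : 'I_s.+1) l := map_poly iota (f i) ^+ (p ^ l).-1 * derT (map_poly iota (f i)).
have -> : derT h = \sum_(j < s.+1) \sum_(i < s.+1 | (i <= j)%N) pi (s - j)%N *: G i (j - i)%N.
  rewrite /h (der_sum (@derTD Omega)); apply: eq_bigr => j _; rewrite derTZ.
  rewrite /phantom_comp rmorph_sum (der_sum (@derTD Omega)) scaler_sumr; apply: eq_bigr => i hi.
  rewrite rmorphM rmorphXn rmorph_nat rmorphXn /= (derTM (p%:R ^+ i)).
  have -> : derT (p%:R ^+ i : {poly Omega}) = 0.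
    by rewrite /derT -polyC_natr -rmorphXn /= derivC mulr0 oppr0.
  rewrite mul0r add0r (derX (@derTM Omega)) /G.
  set X := _ ^+ _.-1; set Y := derT _.
  have -> : p%:R ^+ i * ((p ^ (j - i))%:R * X * Y) = (p%:R ^+ j)%:P * (X * Y).
    have -> : (p%:R ^+ j : Omega) = p%:R ^+ i * p%:R ^+ (j - i) by rewrite -exprD subnKC.
    by rewrite natrX polyCM !rmorphXn /= polyC_natr; ring.
  rewrite mul_polyC scalerA.
  by rewrite divfK ?expf_neq0.
rewrite (exchange_big_dep xpredT) //=; apply: eq_bigr => i _.
rewrite /block /LTq /expo_q raddf_sum mulr_suml.
rewrite (eq_bigr (fun l : 'I_(s - i).+1 => pi (s - i - l)%N *: G i l)); last first.
  by move=> l _; rewrite /= comp_polyZ comp_Xn_poly -scalerAl.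
rewrite -(big_mkord xpredT (fun l => pi (s - i - l)%N *: G i l)).
have -> : \sum_(j < s.+1 | (i <= j)%N) pi (s - j)%N *: G i (j - i)%N =
    \sum_(i <= j < s.+1) pi (s - j)%N *: G i (j - i)%N by rewrite big_geq_mkord.
rewrite -{1}[i : nat]add0n big_addn subSn; last by rewrite -ltnS.
by apply: eq_big_nat => l _; rewrite addnK addnC subnDA.
Qed.

End Phantom.

(** * The radius formula *)

Section Limsup.
Variable R : realType.

Lemma limn_esupE (u : (\bar R)^nat) : limn_esup u = ereal_inf (range (esups u)).
Proof. by rewrite limn_esup_lim; apply/cvg_lim => //; apply: cvg_esups_inf. Qed.

Lemma limn_esup_le (u : (\bar R)^nat) x N :
  (forall n, (N <= n)%N -> (u n <= x)%E) -> (limn_esup u <= x)%E.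
Proof.
move=> h; rewrite limn_esupE; apply: (@le_trans _ _ (esups u N)).
  by apply: ereal_inf_lbound; exists N.
by apply: ub_ereal_sup => _ [n hn <-]; apply: h.
Qed.

Lemma limn_esup_lt (u : (\bar R)^nat) x : (limn_esup u < x)%E ->
  exists N, forall n, (N <= n)%N -> (u n < x)%E.
Proof.
rewrite limn_esupE => /ereal_inf_lt[_ [N _ <-] h]; exists N => n hn.
by apply: le_lt_trans h; apply: ereal_sup_ubound; exists n.
Qed.

Lemma linear_le_geometric (y c : R) : 1 < y ->
  exists N, forall k, (N <= k)%N -> c * k%:R <= y ^+ k.
Proof.
(* Bernoulli's inequality for the square root of [y], once squared, gives quadratic growth in
   [k]. *)
move=> y1; pose z := Num.sqrt y; have z1 : 1 < z by rewrite -sqrtr1 ltr_sqrt // (lt_trans ltr01).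
have z2 : z ^+ 2 = y by rewrite sqr_sqrtr // ltW // (lt_trans ltr01).
pose h := z - 1; have h0 : 0 < h by rewrite subr_gt0.
have zh : z = 1 + h by rewrite /h addrC subrK.
exists (Num.bound (`|c| / h ^+ 2)) => k hk.
have hb : `|c| <= k%:R * h ^+ 2.
  have bp : 0 <= `|c| / h ^+ 2 by rewrite divr_ge0 ?exprn_ge0 ?(ltW h0).
  rewrite -ler_pdivrMr ?exprn_gt0 //; apply: le_trans (ltW (archi_boundP bp)) _.
  by rewrite ler_nat.
have hz : k%:R * h <= z ^+ k.
  by apply: le_trans (_ : _ <= 1 + k%:R * h) _; rewrite ?lerDr // zh; apply: bernoulli_le; apply: ltW.
rewrite -z2 -exprM mulnC exprM.
apply: (@le_trans _ _ ((k%:R * h) ^+ 2)).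
  apply: (@le_trans _ _ (`|c| * k%:R)); first by rewrite ler_wpM2r // ler_norm.
  by rewrite exprMn [X in _ <= X * _]expr2 -mulrA mulrC; apply: ler_wpM2l.
by apply: lerXn2r; rewrite ?nnegrE ?mulr_ge0 ?(ltW h0) // exprn_ge0 // (le_trans _ (ltW z1)).
Qed.

Variable G : nat -> R.
Hypothesis G0 : forall i, 0 <= G i.

Lemma powR_root (x : R) i : 0 <= x -> (0 < i)%N -> (x ^+ i) `^ i%:R^-1 = x.
Proof.
move=> x0 i0; rewrite -powR_mulrn // -powRrM mulfV ?powRr1 //.
by rewrite pnatr_eq0 -lt0n.
Qed.

Lemma root_powR (x : R) i : 0 <= x -> (0 < i)%N -> (x `^ i%:R^-1) ^+ i = x.
Proof.
move=> x0 i0; rewrite -powR_mulrn ?powR_ge0 // -powRrM mulVf ?powRr1 //.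
by rewrite pnatr_eq0 -lt0n.
Qed.

Lemma limn_esup_root_le (c l : R) : 0 < l ->
  (forall i, (0 < i)%N -> G i <= c * i%:R * l ^+ i) ->
  (limn_esup (fun i => (G i `^ i%:R^-1)%:E) <= l%:E)%E.
Proof.
move=> l0 hG; apply/lee_addgt0Pr => e e0.
have y1 : 1 < 1 + e / l by rewrite ltrDl divr_gt0.
have [N hN] := linear_le_geometric c y1.
apply: (@limn_esup_le _ _ (maxn N 1)) => i; rewrite geq_max => /andP[hi i0].
rewrite -EFinD lee_fin -[l + e](powR_root _ i0); last by rewrite addr_ge0 ?ltW.
apply: ge0_ler_powR; rewrite ?nnegrE ?invr_ge0 ?ler0n ?exprn_ge0 ?addr_ge0 ?(ltW l0) ?(ltW e0) //.
apply: le_trans (hG i i0) _; apply: le_trans (ler_wpM2r (exprn_ge0 _ (ltW l0)) (hN i hi)) _.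
rewrite -exprMn; have -> // : (1 + e / l) * l = l + e.
by rewrite mulrDl mul1r divfK // gt_eqF.
Qed.

Lemma limn_esup_root_lt (X : R) : 0 < X ->
  (limn_esup (fun i => (G i `^ i%:R^-1)%:E) < X%:E)%E ->
  exists2 C, 0 <= C & forall i, G i <= C * X ^+ i.
Proof.
move=> X0 /limn_esup_lt[N hN].
have S0 j : 0 <= G j / X ^+ j by rewrite divr_ge0 // exprn_ge0 // ltW.
(* The sum takes care of the finitely many initial indices, the [1] of all later ones. *)
exists (1 + \sum_(j < N.+1) G j / X ^+ j); first by rewrite addr_ge0 ?sumr_ge0.
move=> i; have [hi|hi] := ltnP i N.+1.
  rewrite -ler_pdivrMr ?exprn_gt0 // (bigD1 (Ordinal hi)) //= addrCA lerDl.
  by rewrite addr_ge0 ?sumr_ge0.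
have i0 : (0 < i)%N by apply: leq_trans hi.
apply: (@le_trans _ _ (X ^+ i)); last first.
  by rewrite ler_peMl ?exprn_ge0 ?(ltW X0) // lerDl sumr_ge0.
have := hN i (ltnW hi); rewrite lte_fin => h.
by rewrite -(root_powR (G0 i) i0); apply: lerXn2r; rewrite ?nnegrE ?powR_ge0 ?(ltW X0) ?(ltW h).
Qed.

End Limsup.

Section RadiusFormula.
Variables (R : realType) (F : fieldType) (v : F -> R) (p : nat).
Hypotheses (hv : ultra_seminorm v) (vM : {morph v : x y / x * y}).
Hypotheses (v_eq0 : forall x, v x = 0 -> x = 0).
Hypotheses (pp : prime p) (vp : v p%:R = p%:R^-1).
Variables (pi : nat -> F) (w : R).
Hypotheses (pi_le1 : forall j, v (pi j) <= 1) (pi0 : v (pi 0%N) = w).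
Hypotheses (w0 : 0 < w) (hw : w ^+ p.-1 = p%:R^-1).
Hypothesis LTq_int : forall m n, v (ode (LTq p pi m) n) <= 1.
Variables (s : nat) (n : 'I_s.+1 -> nat).
Hypothesis n_cop : forall i, coprime (n i) p \/ n i = 0%N.
Variables (t : R) (f g : 'I_s.+1 -> {poly F}).
Hypothesis t1 : 1 < t.
Local Notation N := (gauss v t).
Let beta := \max_(i < s.+1) (n i * p ^ (s - i))%N.
Hypotheses (hf : forall i, N (f i) <= t ^+ n i) (hg : forall i, N (g i) <= t ^+ n i).
Hypothesis hgf : forall i, N (g i - f i) * (t ^+ n i) ^+ (p ^ (s - i)).-1 < 1.
Hypothesis sg : forall i, (size (g i) <= (n i).+1)%N.
Hypothesis lg : forall i, (0 < n i)%N -> v (g i)`_(n i) = 1.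
Hypothesis g0 : forall i, n i = 0%N -> g i = 0.

Let G i := N (dconn (@derT F) (\sum_(i < s.+1) block p pi (s - i) (f i)) i).
Let t0 : 0 < t := lt_trans ltr01 t1.
Let G0 i : 0 <= G i. Proof. exact: (gauss_ge0 hv (ltW t0)). Qed.
Let L := limn_esup (fun i => (G i `^ i%:R^-1)%:E).

Let L_le : (L <= (w * t ^+ beta.+1)%:E)%E.
Proof.
rewrite /L; apply: (limn_esup_root_le G0 (c := p%:R)); first by rewrite mulr_gt0 ?exprn_gt0.
move=> i i0; rewrite exprMn mulrA.
have h := sum_LTblock_upper hv vM v_eq0 pp vp LTq_int (ltW t1) hf i.
apply: le_trans h _.
apply: ler_wpM2r; first by rewrite !exprn_ge0 // ltW.
exact: (abs_fact_le hv vM v_eq0 pp vp).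
Qed.

Let L_ge0 : (0 <= L)%E.
Proof.
rewrite /L limn_esupE; apply: le_ereal_inf_tmp => _ [m _ <-].
apply: le_trans (_ : ((G m `^ m%:R^-1)%:E <= _)%E); first by rewrite lee_fin powR_ge0.
by apply: ereal_sup_ubound; exists m => /=.
Qed.

Let L_ge : (0 < beta)%N -> ((w * t ^+ beta.+1)%:E <= L)%E.
Proof.
move=> b0; rewrite leNgt; apply/negP => hL.
set l := w * t ^+ beta.+1 in hL; have l0 : 0 < l by rewrite mulr_gt0 ?exprn_gt0.
have wtl : w * t < l.
  by rewrite ltr_pM2l // -{1}[t]expr1 ltr_eXn2l // ltnS.
(* Choosing [X >= w t] bounds by powers of [X] both the iterates for [f] and the comparison factors
   [|l!| t^l]; there is room below [l] because [beta > 0]. *)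
have [X [LX wtX Xl]] : exists X, [/\ (L < X%:E)%E, w * t <= X & X < l].
  move: hL L_ge0; case: (L) => [x| |] //=; rewrite lte_fin => hx _.
  have hm : Num.max x (w * t) < l by rewrite gt_max hx.
  exists ((Num.max x (w * t) + l) / 2); rewrite lte_fin; split.
  - by apply: le_lt_trans (_ : x <= Num.max x (w * t)) _; rewrite ?le_max ?lexx //; lra.
  - by apply: le_trans (_ : w * t <= Num.max x (w * t)) _; rewrite ?le_max ?lexx ?orbT //; lra.
  - by lra.
have X0 : 0 < X by apply: lt_le_trans wtX; rewrite mulr_gt0.
have [C C0 hC] := limn_esup_root_lt G0 X0 LX.
have y1 : 1 < l / X by rewrite ltr_pdivlMr // mul1r.
(* For [k >= 1], [C (p k + 1) <= C (p + 1) k], and the extra [1] makes the final inequality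
   strict. *)
have [M hM] := linear_le_geometric (C * (p%:R + 1) + 1) y1.
set k := M.+1; have := hM k (leqnSn M); rewrite expr_div_n ler_pdivlMr ?exprn_gt0 //.
have p0 : 0 <= p%:R :> R by [].
have k1 : 1 <= k%:R :> R by rewrite ler1n.
have := sum_LTblock_lower hv vM v_eq0 pp vp pi_le1 pi0 LTq_int n_cop (ltW t1) b0 hf hg hgf sg lg g0
  (k := k) (B := C * (p%:R * k%:R + 1) * X ^+ k).
rewrite -/beta -/l => H1 H2.
have {}H1 : l ^+ k <= C * (p%:R * k%:R + 1) * X ^+ k.
  apply: H1 => [|j hj].
    by rewrite mulr_ge0 ?exprn_ge0 ?(ltW X0) // mulr_ge0 // addr_ge0 // mulr_ge0.
  have -> : C * (p%:R * k%:R + 1) * X ^+ k = (C * X ^+ j) * ((p%:R * k%:R + 1) * X ^+ (k - j)).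
    have -> : X ^+ k = X ^+ j * X ^+ (k - j) by rewrite -exprD subnKC.
    ring.
  apply: ler_pM; rewrite ?G0 ?mulr_ge0 ?exprn_ge0 ?(usn_ge0 hv) ?(ltW t0) //; first exact: hC.
  (* The factorial estimate needs a positive index; the [+ 1] in [B] covers the case [j = k]. *)
  have [->|kj0] := posnP (k - j)%N.
    rewrite !expr0 !mulr1 (abs1 vM v_eq0) lerDr mulr_ge0 //.
  apply: (@le_trans _ _ (p%:R * (k - j)%:R * (w * t) ^+ (k - j))).
    rewrite exprMn mulrA; apply: ler_wpM2r; first by rewrite exprn_ge0 // ltW.
    exact: (abs_fact_le hv vM v_eq0 pp vp).
  apply: ler_pM; rewrite ?mulr_ge0 ?exprn_ge0 ?mulr_ge0 ?(ltW w0) ?(ltW t0) //.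
    apply: (@le_trans _ _ (p%:R * k%:R)); last by rewrite lerDl.
    by apply: ler_wpM2l => //; rewrite ler_nat leq_subr.
  by apply: lerXn2r; rewrite ?nnegrE ?mulr_ge0 ?(ltW w0) ?(ltW t0) ?(ltW X0).
have Xk : 0 < X ^+ k by rewrite exprn_gt0.
have : (C * (p%:R + 1) + 1) * k%:R * X ^+ k <= C * (p%:R * k%:R + 1) * X ^+ k by apply: le_trans H2 H1.
rewrite ler_pM2r //; have : C * 1 <= C * k%:R by apply: ler_wpM2l.
set x := k%:R in k1 *; set y := p%:R; nra.
Qed.

Lemma radius_formula :
  Order.min (t^-1)%:E (w%:E * L^-1)%E = (t ^- beta.+1)%:E.
Proof.
have l0 b : 0 < w * t ^+ b by rewrite mulr_gt0 ?exprn_gt0.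
have [b0|b0] := posnP beta.
  rewrite b0 expr1; apply: min_idPl.
  have : ((w * t)%:E^-1 <= L^-1)%E.
    rewrite inve_pge ?inveK ?inE ?lee_fin ?inve_ge0 ?lee_fin ?(ltW (l0 1%N)) //.
    by have := L_le; rewrite b0 expr1.
  have wt0 : w * t != 0 by rewrite gt_eqF // mulr_gt0.
  rewrite inver (negbTE wt0) => /(lee_wpmul2l (_ : (0 <= w%:E)%E)); rewrite lee_fin (ltW w0) => /(_ isT).
  by rewrite -EFinM invfM mulrA divff ?mul1r // gt_eqF.
have -> : L = (w * t ^+ beta.+1)%:E by apply/eqP; rewrite eq_le L_le L_ge.
rewrite inver gt_eqF // -EFinM invfM mulrA divff ?mul1r ?gt_eqF //.
apply: min_idPr; rewrite lee_fin lef_pV2 ?posrE ?exprn_gt0 //.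
by rewrite exprS ler_peMr ?(ltW t0) // exprn_ege1 // ltW.
Qed.

End RadiusFormula.

(** * Radii close to 1 and the irregularity *)

Section NearOne.
Local Open Scope classical_set_scope.
Local Open Scope ring_scope.

Lemma near1_mul_exprV_lt1 (R : realType) (c : R) m : c < 1 ->
  \forall rho \near (1 : R)^'-, c * rho^-1 ^+ m < 1.
Proof.
move=> c1; have hV : rho^-1 @[rho --> (1 : R)^'-] --> (1^-1 : R).
  by apply: cvg_at_left_filter; apply: inv_continuous; exact: oner_neq0.
have h : c * rho^-1 ^+ m @[rho --> (1 : R)^'-] --> c * 1^-1 ^+ m.
  exact: cvgMl_tmp (cvg_comp _ _ hV (@exprn_continuous R m 1^-1)).
rewrite invr1 expr1n mulr1 in h.
by apply: (cvgr_lt c h).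
Qed.

End NearOne.

Lemma gauss_lt (R : realFieldType) (B : nzRingType) (N : B -> R) t (q : {poly B}) M :
  0 < M -> (forall i, N q`_i * t ^+ i < M) -> gauss N t q < M.
Proof.
move=> M0 h; rewrite /gauss; elim/big_ind: _ => // x y x0 y0.
by rewrite gt_max x0.
Qed.

Lemma residue_abs (R : realType) (K k : fieldType) (v : K -> R) (red : K -> k) x :
  residue_map v red -> v x <= 1 -> red x != 0 -> v x = 1.
Proof.
move=> hred x1 h; apply/eqP; rewrite eq_le x1 /= leNgt; apply/negP => lt1.
by move/eqP: h; apply; apply/(red_ker hred).
Qed.

Theorem corollary4p32 (R : realType) (p : nat)
  (K : fieldType) (absK : K -> R)
  (k : fieldType) (red : K -> k)
  (Omega : closedFieldType) (iota : {rmorphism K -> Omega}) (abs : Omega -> R)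
  (P : nat -> K) (pi : nat -> Omega)
  (s : nat) (fbar : 'I_s.+1 -> {poly k}) (f : 'I_s.+1 -> {poly K})
  (M : rank_one_module (robba_ext iota absK (adjoin iota (pi s)))) :
  prime p ->
  ultrametric_abs absK -> vcomplete absK -> absK p%:R = p%:R^-1 ->
  residue_map absK red ->
  algebraic_closure iota -> ultrametric_abs abs ->
  (forall x, abs (iota x) = absK x) ->
  lubin_tate absK p P ->
  tate_generator iota abs P pi ->
  in_Ws (Tinv_polys setT) fbar ->
  lifting absK red fbar f ->
  is_M0 iota p pi f M ->
  (forall j, coprime (pole_order (fbar j)) p \/ pole_order (fbar j) = 0%N) ->
  is_Irr abs p M (\max_(j < s.+1) (pole_order (fbar j) * p ^ (s - j))%N).
Proof.
move=> pp hK _ absKp hred _ hO abs_iota hP hpi hfbar [hf hlift] hM hcop.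
pose n j := pole_order (fbar j); set beta := \max_(j < s.+1) _.
have sO := ultrametric_abs_seminorm hO.
have absM : {morph abs : x y / x * y} := uabsM hO.
have abs_eq0 x : abs x = 0 -> x = 0 := (uabs_eq0 hO x).1.
have absp : abs p%:R = p%:R^-1 by rewrite -(rmorph_nat iota) abs_iota.
have nz := natF_neq0 sO absM abs_eq0 pp absp.
have nzp : p%:R != 0 :> Omega by case: (p) (prime_gt0 pp).
have LTint := LTq_integral pp absKp hO abs_iota hP hpi.
have hw := abs_pi0 pp hK absKp hO abs_iota hP hpi.
set w := abs (pi 0%N) in hw.
have w0 : 0 < w by rewrite (abs_gt0 sO) // (tate_neq0 hpi).
have pi_le1 j : abs (pi j) <= 1 by apply/ltW/(tate_lt1 hpi).
have p1 : (0 < p.-1)%N by have := prime_gt1 pp; lia.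
have powRw : abs p%:R `^ (p.-1)%:R^-1 = w by rewrite absp -hw powR_root // ltW.
have f0 i : (f i)`_0 = 0 by have [] := hf i.
have fint i j : absK (f i)`_j <= 1 by have [_ /(_ j)] := hf i.
pose Fi i := map_poly iota (f i); pose g i := take_poly (n i).+1 (Fi i).
have Fcoef i j : abs (Fi i)`_j = absK (f i)`_j by rewrite coef_map abs_iota.
have Fsmall i j : (n i < j)%N -> abs (Fi i)`_j < 1.
  move=> hj; rewrite Fcoef; apply/(red_ker hred (fint i j)).
  rewrite hlift nth_default //; apply: leq_trans hj; rewrite /n /pole_order.
  exact: leqSpred.
have Flead i : (0 < n i)%N -> abs (Fi i)`_(n i) = 1.
  move=> ni; rewrite Fcoef; apply: (residue_abs hred) => //.
  rewrite hlift /n /pole_order -lead_coefE lead_coef_eq0 -size_poly_eq0.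
  by move: ni; rewrite /n /pole_order; case: (size _).
have gcoef i j : (g i)`_j = if (j <= n i)%N then (Fi i)`_j else 0.
  by rewrite coef_take_poly ltnS.
have connE : conn M = laurent_of_poly (- ('X * (\sum_(j < s.+1)
    (pi (s - j)%N / p%:R ^+ j) *: map_poly iota (phantom_comp p f j))^`())).
  exact: (dlog_fps_exp nz (pi_exp_log0 iota pi pp f0) hM).
have RayE rho : 0 < rho -> Ray abs p M rho = Order.min rho%:E
    (w%:E * (limn_esup (fun i => (gauss abs rho^-1 (dconn (@derT Omega)
      (\sum_(i < s.+1) block p pi (s - i) (Fi i)) i) `^ i%:R^-1)%:E))^-1)%E.
  move=> r0; rewrite /Ray powRw; congr (Order.min _ (_ * (limn_esup _)^-1)%E).
  apply/funext => i; rewrite connE (lconn_poly sO abs_eq0) (gauss_norm_poly sO) //.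
  (* Division by [T] is multiplication by [Z], and [- (Z * (Z * h'))] is [derT h]. *)
  rewrite poweR_EFin -(derT_pi_exp_log iota pi f nzp).
  by rewrite mulrN mulrA -expr2.
have key : (\forall rho \near (1 : R)^'-, Ray abs p M rho = (rho ^+ beta.+1)%:E)%classic.
  (* The exponent is the one in the closeness condition between [f_i] and its truncation. Bounding
     [j] by the degrees leaves finitely many conditions, hence a common neighbourhood of [1]. *)
  have small : (\forall rho \near (1 : R)^'-, forall (i : 'I_s.+1)
      (j : 'I_(\max_(l < s.+1) size (Fi l)).+1), (n i < j)%N ->
      abs (Fi i)`_j * rho^-1 ^+ (j + n i * (p ^ (s - i)).-1) < 1)%classic.
    apply: filter_forall => i; apply: filter_forall => j.
    have [hj|hj] := ltnP (n i) j; last by apply: nearW.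
    by near=> rho => _; near: rho; apply: near1_mul_exprV_lt1; apply: Fsmall.
  have r1 : (\forall rho \near (1 : R)^'-, rho < 1 :> R)%classic by exact: nbhs_left_lt.
  have r0 : (\forall rho \near (1 : R)^'-, 0 < rho :> R)%classic by apply: nbhs_left_gt; exact: ltr01.
  near=> rho.
  have rho0 : 0 < rho by near: rho.
  have rho1 : rho < 1 by near: rho.
  have smallo : forall (i : 'I_s.+1) (j : 'I_(\max_(l < s.+1) size (Fi l)).+1), (n i < j)%N ->
      abs (Fi i)`_j * rho^-1 ^+ (j + n i * (p ^ (s - i)).-1) < 1 by near: rho.
  have smallr : forall (i : 'I_s.+1) j, (n i < j)%N ->
      abs (Fi i)`_j * rho^-1 ^+ (j + n i * (p ^ (s - i)).-1) < 1.
    move=> i j hj; have [hs|hs] := ltnP j (\max_(l < s.+1) size (Fi l)).+1.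
      exact: (smallo i (Ordinal hs)).
    rewrite nth_default ?(usn0 sO) ?mul0r //; apply: leq_trans (ltnW hs).
    exact: (leq_bigmax (F := fun l : 'I_s.+1 => size (Fi l))).
  set t := rho^-1 in smallr *; have t1 : 1 < t by rewrite invf_gt1.
  have t0 : 0 <= t by rewrite invr_ge0 ltW.
  have main : forall i j, (j <= n i)%N -> abs (Fi i)`_j * t ^+ j <= t ^+ n i.
    move=> i j hj; rewrite -[X in _ <= X]mul1r; apply: ler_pM; rewrite ?exprn_ge0 ?(usn_ge0 sO) //.
      by rewrite Fcoef.
    by rewrite ler_weXn2l // ltW.
  rewrite RayE // -{1}[rho]invrK -/t.
  rewrite (radius_formula sO absM abs_eq0 pp absp pi_le1 erefl w0 hw LTint hcop (g := g) t1).
  - by rewrite /t exprVn invrK.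
  - move=> i; apply: gauss_le => [|j]; rewrite ?exprn_ge0 //.
    have [hj|hj] := leqP j (n i); first exact: main.
    (* The same smallness bounds the coefficients beyond [n i], since its exponent is at least
       [j]. *)
    apply: (@le_trans _ _ 1); last by rewrite exprn_ege1 // ltW.
    apply: le_trans (ltW (smallr i j hj)); apply: ler_wpM2l; first exact: (usn_ge0 sO).
    by rewrite ler_weXn2l ?leq_addr // ltW.
  - move=> i; apply: gauss_le => [|j]; rewrite ?exprn_ge0 // gcoef.
    by case: ifP => hj; [exact: main|rewrite (usn0 sO) mul0r exprn_ge0].
  - move=> i; have T0 m : 0 < t ^+ m by rewrite exprn_gt0 // (lt_trans ltr01).
    rewrite -exprM -ltr_pdivlMr // mul1r; apply: gauss_lt => [|j]; rewrite ?invr_gt0 //.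
    rewrite coefB gcoef; case: (leqP j (n i)) => hj.
      by rewrite subrr (usn0 sO) mul0r invr_gt0.
    by rewrite sub0r (absN sO) -[_^-1]mul1r ltr_pdivlMr // -mulrA -exprD smallr.
  - by move=> i; apply: size_take_poly.
  - by move=> i ni; rewrite gcoef leqnn Flead.
  (* For [n i = 0] the truncation keeps only the constant term, which vanishes. *)
  - move=> i ni; apply/polyP => j; rewrite gcoef (ni : n i = 0%N) leqn0 coef0.
    by case: eqP => // ->; rewrite coef_map /= f0 rmorph0.
(* Solvability is read off the radius formula, as [rho ^+ beta.+1] tends to [1]. *)
split=> //; rewrite /solvable_module.
have h : ((fun rho : R => (rho ^+ beta.+1)%:E) @ (1 : R)^'- --> (1 ^+ beta.+1)%:E)%classic.
  apply: cvg_EFin; first by near=> x.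
  by apply: cvg_at_left_filter; exact: exprn_continuous.
rewrite expr1n in h; apply: cvg_trans h; apply: near_eq_cvg.
by near=> rho; apply/esym; near: rho.
Unshelve. all: by end_near.
Qed.
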